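(* Assume $\eta\in(0,\tfrac12]$ and $\sigma<\infty$. Then: (1) For fixed $E\in(-2,2)$ and $R<\infty$ there is $c>0$ such that for any $t>0$ and all large $n$, on an event of probability no less than $1-c/t$, both of the following hold: (a) $$\max_{0\le\ell\le n,\ |\lambda|\le R}\operatorname{Tr}\big(M^\lambda_\ell (M^{\lambda}_\ell)^*\big)<t;$$ (b) for every eigenvector $\psi$ of $H_n$ that is $\ell^2$-normalized and has eigenvalue in $[E-\frac{R}{\rho n},E+\frac{R}{\rho n}]$, $$\frac{2}{(n+1)t^2}<|\psi_\ell|^2+|\psi_{\ell+1}|^2<\frac{2t^2}{n+1},\qquad 0\le\ell\le n.$$ (2) For any $R>0$, let $\Delta_n(E)=\big(E-\frac{R}{n\rho(E)},E+\frac{R}{n\rho(E)}\big)$ and let $N_n(E)$ be the number of eigenvalues of $H_n$ belonging to $\Delta_n(E)$. Then for arbitrary $\epsilon>0$, $$\sup_n\ \sup_{E\in(-2+\epsilon,2-\epsilon)}\mathbb E\big[N_n(E)^{3/2}\big]<\infty.$$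
   Context: Fix $\sigma>0$. The random variables $\omega_1,\omega_2,\dots$ are independent, with mean $0$, variance $1$ and (uniformly) bounded third absolute moments. $H_n$ is the random Schrödinger operator $$(H_n\psi)_\ell=\psi_{\ell-1}+\psi_{\ell+1}+v_{\ell,n}\psi_\ell,\quad 1\le\ell\le n,\qquad \psi_0=\psi_{n+1}=0,\qquad v_{\ell,n}=\sigma\frac{\omega_\ell}{n^\eta(n+1-\ell)^{\frac12-\eta}}.$$ For $E\in(-2,2)$ set $\rho=\rho(E)=1/\sqrt{1-E^2/4}$, and $T(x)=\begin{pmatrix}x&-1\\1&0\end{pmatrix}$. For $\lambda\in\mathbb C$ and $1\le\ell\le n$ put $\epsilon_\ell=\frac{\lambda}{\rho n}-\frac{\sigma\omega_\ell}{n^\eta(n+1-\ell)^{\frac12-\eta}}$, and $$M^\lambda_\ell=T(E+\epsilon_\ell)T(E+\epsilon_{\ell-1})\cdots T(E+\epsilon_1),\qquad M^\lambda_0=I,\qquad 0\le\ell\le n$$ (the dependence on $n$ and $E$ is suppressed). $A^*$ denotes the conjugate transpose. *)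

(* Defs.v *)
From HB Require Import structures.
From mathcomp Require Import all_boot all_order all_algebra.
From mathcomp Require Import finmap complex.
From mathcomp Require Import all_classical all_reals all_analysis.
Import Order.TTheory GRing.Theory Num.Theory.
Import numFieldNormedType.Exports.

Set Implicit Arguments.
Unset Strict Implicit.
Unset Printing Implicit Defensive.

Local Open Scope classical_set_scope.
Local Open Scope complex_scope.
Local Open Scope ring_scope.

(* Mutual independence of the subfamily of X indexed by D. *)
Definition mutually_independent (d : measure_display) (T : measurableType d)
    (R : realType) (P : probability T R) (I : choiceType) (D : set I)
    (X : I -> {RV P >-> R}) : Prop :=
  forall (J : {fset I}) (B : I -> set R),
    [set` J] `<=` D ->
    (forall i, measurable (B i)) ->
    P (\bigcap_(i in [set` J]) (X i @^-1` B i)) =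
    (\prod_(i <- J) P (X i @^-1` B i))%E.

Section Model.
Variable R : realType.

(* [om : nat -> R] is a realization of the random sequence; only the entries
   om 1, ..., om n are used by the objects of size n. *)

Definition potential (sigma eta : R) (om : nat -> R) (n l : nat) : R :=
  sigma * (om l / (n%:R `^ eta * (n.+1 - l)%:R `^ (2^-1 - eta))).

(* H_n as an operator on C^n; row and column i : 'I_n stand for the site i.+1. *)
Definition schrodinger (sigma eta : R) (om : nat -> R) (n : nat) : 'M[R[i]]_n :=
  \matrix_(i, j) ((i == j.+1 :> nat)%:R + (j == i.+1 :> nat)%:R
                  + (potential sigma eta om n i.+1)%:C * (i == j)%:R).

(* The value psi_l of a vector at the site l, with the boundary convention
   psi_0 = psi_(n+1) = 0: at most one index satisfies i.+1 = l, and none does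
   unless 1 <= l <= n. *)
Definition site (n : nat) (psi : 'cV[R[i]]_n) (l : nat) : R[i] :=
  \sum_(i < n | i.+1 == l) psi i 0.

Lemma site_ord n (psi : 'cV[R[i]]_n) (i : 'I_n) : site psi i.+1 = psi i 0.
Proof. by rewrite /site (big_pred1 i) // => j; rewrite eqSS. Qed.

Lemma schrodingerE sigma eta om n (psi : 'cV[R[i]]_n) (i : 'I_n) :
  (schrodinger sigma eta om n *m psi) i 0 =
    site psi i + site psi i.+2
    + (potential sigma eta om n i.+1)%:C * site psi i.+1.
Proof.
rewrite mxE site_ord /site.
under eq_bigr do rewrite mxE !mulrDl.
rewrite !big_split /=; congr (_ + _ + _).
- rewrite [RHS]big_mkcond; apply: eq_bigr => j _.
  by rewrite eq_sym; case: eqP => _; rewrite ?mul1r ?mul0r.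
- rewrite [RHS]big_mkcond; apply: eq_bigr => j _.
  by rewrite eqSS; case: eqP => _; rewrite ?mul1r ?mul0r.
- rewrite (bigD1 i) //= eqxx mulr1 big1 ?addr0// => j /negPf ji.
  by rewrite eq_sym ji mulr0 mul0r.
Qed.

Definition l2_normalized (n : nat) (psi : 'cV[R[i]]_n) : Prop :=
  \sum_(i < n) `|psi i 0| ^+ 2 = 1.

Definition rho (E : R) : R := (Num.sqrt (1 - E ^+ 2 / 4))^-1.

Definition Tmx (x : R[i]) : 'M[R[i]]_2 :=
  \matrix_(i, j) (nth [::] [:: [:: x; -1];
                               [:: 1;  0]] i)`_j.

Definition epsilon (sigma eta : R) (om : nat -> R) (E : R) (n : nat)
    (lam : R[i]) (l : nat) : R[i] :=
  lam / (rho E * n%:R)%:C - (potential sigma eta om n l)%:C.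

Fixpoint transfer (sigma eta : R) (om : nat -> R) (E : R) (n : nat)
    (lam : R[i]) (l : nat) : 'M[R[i]]_2 :=
  if l is k.+1 then
    Tmx (E%:C + epsilon sigma eta om E n lam k.+1)
      *m transfer sigma eta om E n lam k
  else 1%:M.

(* Number of eigenvalues of A in a set of reals, each real mu being counted with
   the dimension of its eigenspace (which is 0 for all but finitely many mu). *)
Definition eigencount (n : nat) (A : 'M[R[i]]_n) (D : set R) : nat :=
  \big[addn/0%N]_(mu \in D) \rank (eigenspace A mu%:C).

Definition window (r E : R) (n : nat) : set R :=
  `]E - r / (n%:R * rho E), E + r / (n%:R * rho E)[.

End Model.

(* Main.v *)
(* The quadratic form q(a, b) = a^2 - E a b + b^2 is positive definite for
   |E| < 2 and invariant under T(E).  The columns of M^lam_l are polynomial in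
   z = lam / s; let N_l be the sum of q over the coefficients of both columns.
   Then N_(l+1) is a quadratic polynomial in omega_(l+1) with coefficients
   depending on omega_1, ..., omega_l, and its conditional mean is at most
   (1 + a_l) N_l, where sum_l a_l is bounded uniformly in n.  Since
   |sum_j c_j z^j|^2 <= 2 sum_j c_j^2 for |z| <= 1/2, N_l dominates Tr (M M^* )
   simultaneously for all |lam| <= s / 2, so the maximal inequality for
   nonnegative supermartingales gives (1a).  A solution psi has
   |psi_l|^2 + |psi_(l+1)|^2 within a factor t of its value at l = 0, because
   det M = 1; summing over l gives (1b).

   For (2), f(lam) = (M^lam_n)_00 is the characteristic polynomial of H_n.  Its
   zeros are real, so 5^k |f(ir)|^2 <= |f(3ir)|^2 when k eigenvalues lie in the
   window.  The Wronskian identity and det M = 1 bound 1 / |f(ir)| in terms of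
   N_n and the average A of N_0, ..., N_(n-1), whence 5^k <= C (N_n A)^2 and
   k^(3/2) <= k^2 <= C' (N_n + A), which has bounded mean. *)
From HB Require Import structures.
Require Import Defs.
From mathcomp Require Import all_boot all_order all_algebra.
From mathcomp Require Import finmap complex.
From mathcomp Require Import all_classical all_reals all_analysis.
From mathcomp Require Import measurable_realfun ring lra.
Import Order.TTheory GRing.Theory Num.Theory.
Import numFieldNormedType.Exports.

Set Implicit Arguments.
Unset Strict Implicit.
Unset Printing Implicit Defensive.

Local Open Scope classical_set_scope.
Local Open Scope complex_scope.
Local Open Scope sesquilinear_scope.
Local Open Scope ring_scope.

(** * Independence and the maximal inequality *)

Section History.
Context (R : realType) (d : measure_display) (T : measurableType d).
Context (P : probability T R) (omega : nat -> {RV P >-> R}).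

(** A pi-system generating the sigma-algebra of omega_1, ..., omega_l. Indices start at 1, as in the
    independence hypothesis. *)
Definition cylinders (l : nat) : set (set T) :=
  [set A | exists2 B : nat -> set R, (forall i, measurable (B i)) &
     A = \bigcap_(i in [set i | (0 < i <= l)%N]) (omega i @^-1` B i)].

(** The space [T] with the sigma-algebra of the first [l] variables: measurability of a function on
    [history l] expresses that it is adapted at time [l]. *)
Definition history (l : nat) := g_sigma_algebraType (cylinders l).

Lemma cylinders_setI_closed l : setI_closed (cylinders l).
Proof.
move=> _ _ [B mB ->] [C mC ->]; exists (fun i => B i `&` C i).
  by move=> i; exact: measurableI.
by rewrite -bigcapI.
Qed.

Lemma cylinders_setT l : cylinders l setT.
Proof.
exists (fun=> setT) => //.
by apply/seteqP; split.
Qed.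

Lemma cylinders_measurable l : cylinders l `<=` @measurable _ T.
Proof.
move=> _ [B mB ->].
by apply: bigcap_measurableType => i _; exact: measurable_funPTI.
Qed.

Lemma measurable_history l (A : set T) :
  measurable (A : set (history l)) -> measurable A.
Proof. by apply: smallest_sub;
  [exact: sigma_algebra_measurable|exact: cylinders_measurable]. Qed.

Lemma measurable_fun_history l d' (S : measurableType d') (f : T -> S) :
  measurable_fun setT (f : history l -> S) -> measurable_fun setT f.
Proof.
move=> mf _ B mB; rewrite setTI.
by apply: (@measurable_history l); rewrite -[X in measurable X]setTI; exact: mf.
Qed.

Lemma measurable_omega_history l i : (0 < i <= l)%N ->
  measurable_fun setT (omega i : history l -> R).
Proof.
move=> il _ B mB; rewrite setTI; apply: sub_sigma_algebra.
exists (fun j => if j == i then B else setT).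
  by move=> j; case: ifP.
apply/seteqP; split => [w Bw j /= _|w /(_ i il)/=]; last by rewrite eqxx.
by case: eqP => [->|].
Qed.

Hypothesis omega_indep : mutually_independent [set l : nat | (0 < l)%N] omega.

(** For fixed [B] both sides are finite measures in [A]. They agree on the pi-system of cylinders,
    hence on the sigma-algebra it generates. *)
Lemma indep_history l (A : set T) (B : set R) :
  measurable (A : set (history l)) -> measurable B ->
  (P (A `&` omega l.+1 @^-1` B) = P A * P (omega l.+1 @^-1` B))%E.
Proof.
move=> mA mB.
have mO : measurable (omega l.+1 @^-1` B) by exact: measurable_funPTI.
pose m1 : {measure set T -> \bar R} := mrestr P mO.
pose r : {nonneg R} := NngNum (fine_ge0 (measure_ge0 P (omega l.+1 @^-1` B))).
pose m2 : {measure set T -> \bar R} := mscale r P.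
have rE : r%:num%:E = P (omega l.+1 @^-1` B).
  by rewrite /= fineK// fin_num_measure.
suff : m1 A = m2 A by rewrite /m1/m2/= /mrestr /mscale rE muleC.
apply: (g_sigma_algebra_measure_unique (cylinders l) _ (fun=> setT)) => //.
- exact: cylinders_measurable.
- by move=> _; exact: cylinders_setT.
- by rewrite bigcup_const//; exists 0%N.
- exact: cylinders_setI_closed.
- move=> _ [C mC ->]; rewrite /m1 /m2 /= /mrestr /mscale rE.
  (* Intersecting a cylinder with the event on omega_(l+1) gives the cylinder of length [l.+1] with
     [B] in the last slot. *)
  pose C' i := if (i == l.+1) then B else C i.
  have mC' i : measurable (C' i) by rewrite /C'; case: ifP.
  have J0 (k : nat) : [set` [fset i in iota 1 k]%fset] `<=` [set i :
    nat | (0 < i)%N].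
    by move=> i /=; rewrite in_fset /= mem_iota => /andP[].
  have JE (k : nat) (D : nat -> set R) :
    \bigcap_(i in [set` [fset i in iota 1 k]%fset]) (omega i @^-1` D i) =
    \bigcap_(i in [set i | (0 < i <= k)%N]) (omega i @^-1` D i).
    by congr (bigcap _ _); apply/seteqP; split => i /=;
      rewrite in_fset /= mem_iota add1n ltnS.
  have BE (k : nat) (D : nat -> set R) :
    (\prod_(i <- [fset i in iota 1 k]%fset) P (omega i @^-1` D i) =
     \prod_(1 <= i < k.+1) P (omega i @^-1` D i))%E.
    rewrite /index_iota subn1 /=; apply: perm_big.
    apply: uniq_perm; [exact: fset_uniq|exact: iota_uniq|].
    by move=> i; rewrite in_fset.
  have H k D mD := @omega_indep [fset i in iota 1 k]%fset D (J0 k) mD.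
  transitivity (P (\bigcap_(i in [set i | (0 < i <=
    l.+1)%N]) (omega i @^-1` C' i))).
    congr (P _); apply/seteqP; split => w /=.
      move=> [Cw Bw] i /= /andP[i0]; rewrite leq_eqVlt /C'.
      by case: eqP => [->//|_ /= il]; apply: Cw => /=; rewrite i0.
    move=> Hw; split.
      move=> i /= /andP[i0 il]; have := Hw i; rewrite /= i0 (leqW il) /C'.
      by case: eqP => [E|_ /(_ isT)//]; move: il; rewrite E ltnn.
    by have := Hw l.+1; rewrite /= leqnn /C' eqxx => /(_ isT).
  rewrite -JE H// BE big_nat_recr//= /C' eqxx muleC; congr (_ * _)%E.
  rewrite -JE H// BE big_nat_cond [RHS]big_nat_cond; apply: eq_bigr => i.
  by rewrite andbT => /andP[_ il]; rewrite ltn_eqF.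
- by move=> k; rewrite /m1 /= /mrestr setTI;
    apply: (le_lt_trans (probability_le1 P _)) => //; rewrite ltry.
Qed.

End History.

(** * Integrals of quadratic polynomials in one standardized variable *)

Section Quadratic.
Context (R : realType) (d : measure_display) (T : measurableType d).
Context (P : probability T R).

Definition standardized (X : {RV P >-> R}) : Prop :=
  [/\ P.-integrable setT (EFin \o X),
      (\int[P]_w (X w)%:E = 0)%E,
      P.-integrable setT (EFin \o (fun w => X w ^+ 2)) &
      (\int[P]_w (X w ^+ 2)%:E = 1)%E].

Lemma integral_cst_probability (r : R) : (\int[P]__ r%:E = r%:E)%E.
Proof. by have := expectation_cst P r; rewrite unlock. Qed.

(** Both |x| and x^2 are dominated by 1 + |x|^3, which is integrable by the third moment bound.
    Since the mean is 0, the variance is the second moment. *)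
Lemma standardized_third_moment (X : {RV P >-> R}) (K : R) :
  ('E_P[X] = 0)%E -> ('V_P[X] = 1)%E ->
  ('E_P[(fun w => `|X w| ^+ 3)%R] <= K%:E)%E -> standardized X.
Proof.
move=> m0 v1 K3.
have mX : measurable_fun setT X by exact: measurable_funP.
have dom : P.-integrable setT (EFin \o (fun w => 1 + `|X w| ^+ 3)).
  apply/integrableP; split.
    apply/measurable_EFinP; apply: measurable_funD => //.
    by apply: measurable_funX; exact: measurableT_comp.
  under eq_integral => w _ do
    rewrite /= ger0_norm ?addr_ge0 ?exprn_ge0// EFinD.
  rewrite ge0_integralD//; last first.
    by apply/measurable_EFinP; apply: measurable_funX; exact: measurableT_comp.
  rewrite integral_cst_probability.
  rewrite unlock in K3.
  by rewrite lte_add_pinfty ?ltry// (le_lt_trans K3) ?ltry.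
have b1 (x : R) : 0 <= x -> x <= 1 + x ^+ 3.
  by move=> x0; have [x1|x1] := lerP x 1; have := exprn_ge0 3 x0; nra.
have b2 (x : R) : 0 <= x -> x ^+ 2 <= 1 + x ^+ 3.
  by move=> x0; have [x1|x1] := lerP x 1; have := exprn_ge0 3 x0; nra.
split.
- apply: le_integrable dom => //; first exact/measurable_EFinP.
  move=> w _; rewrite /= lee_fin [leRHS]ger0_norm ?addr_ge0 ?exprn_ge0//.
  exact: b1.
- by rewrite unlock in m0.
- apply: le_integrable dom => //.
    by apply/measurable_EFinP; exact: measurable_funX.
  move=> w _; rewrite /= lee_fin [leRHS]ger0_norm ?addr_ge0 ?exprn_ge0//.
  by rewrite normrX b2.
- move: v1; rewrite /variance unlock m0 /= unlock => <-.
  by apply: eq_integral => w _ /=; rewrite !fctE /= subr0 expr2.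
Qed.

Lemma integral_quadratic (X : {RV P >-> R}) (a b c : R) : standardized X ->
  P.-integrable setT (EFin \o (fun w => a + b * X w + c * X w ^+ 2)) /\
  (\int[P]_w (a + b * X w + c * X w ^+ 2)%:E = (a + c)%:E)%E.
Proof.
case=> iX X0 iX2 X1.
have ia : P.-integrable setT (EFin \o cst a).
  exact: finite_measure_integrable_cst.
have ibX : P.-integrable setT (EFin \o (fun w => b * X w)).
  exact: (@integrableZl _ _ _ P setT measurableT b _ iX).
have icX : P.-integrable setT (EFin \o (fun w => c * X w ^+ 2)).
  exact: (@integrableZl _ _ _ P setT measurableT c _ iX2).
have iab : P.-integrable setT (EFin \o (fun w => a + b * X w)).
  exact: (integrableD measurableT ia ibX).
split; first exact: (integrableD measurableT iab icX).
rewrite -[LHS]/(\int[P]_w ((fun w => (a + b * X w)%:E) \+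
                          (fun w => (c * X w ^+ 2)%:E))%E w)%E.
rewrite integralD_EFin//=.
rewrite -[X in (X + _)%E]/(\int[P]_w ((fun=> a%:E) \+ (fun w =>
  (b * X w)%:E))%E w)%E.
rewrite integralD_EFin//=.
under [X in (_ + X + _)%E]eq_integral do rewrite EFinM.
under [X in (_ + _ + X)%E]eq_integral do rewrite EFinM.
rewrite !integralZl// X0 X1 integral_cst_probability.
by rewrite mule0 adde0 mule1 -EFinD.
Qed.

Lemma distribution_quadratic (X : {RV P >-> R}) (a b c : R) : standardized X ->
  (\int[distribution P X]_y (a + b * y + c * y ^+ 2)%:E = (a + c)%:E)%E.
Proof.
move=> sX; have [iX <-] := integral_quadratic a b c sX.
rewrite integral_distribution//.
apply/measurable_EFinP; apply: measurable_funD; last first.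
  by apply: measurable_funM => //; exact: measurable_funX.
by apply: measurable_funD => //; exact: measurable_funM.
Qed.

End Quadratic.

(** * Integrating out the next variable *)

Section Conditioning.
Context (R : realType) (d : measure_display) (T : measurableType d).
Context (P : probability T R) (omega : nat -> {RV P >-> R}).
Hypothesis omega_indep : mutually_independent [set l : nat | (0 < l)%N] omega.
Hypothesis omega_std : forall l, (0 < l)%N -> standardized (omega l).

(** By independence the joint law of the history and omega_(l+1) is a product, so the last variable
    can be integrated first. Nonnegativity for every real [y] allows Tonelli's theorem, without
    integrability of [a], [b], [c]. *)
Lemma integral_next_quadratic l (a b c : T -> R) :
  measurable_fun setT (a : history omega l -> R) ->
  measurable_fun setT (b : history omega l -> R) ->
  measurable_fun setT (c : history omega l -> R) ->
  (forall w y, 0 <= a w + b w * y + c w * y ^+ 2) ->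
  (\int[P]_w (a w + b w * omega l.+1 w + c w * omega l.+1 w ^+ 2)%:E =
   \int[P]_w (a w + c w)%:E)%E.
Proof.
move=> ma mb mc ge0.
pose H := history omega l.
have mid : measurable_fun setT (id : T -> H).
  by move=> _ B mB; rewrite setTI; exact: measurable_history mB.
(* The identity as a random element of the history space: its law is [P] on the history
   sigma-algebra. *)
pose idH : {mfun T >-> H} := HB.pack (id :
  T -> H) (isMeasurableFun.Build _ _ _ _ _ mid).
have mpair : measurable_fun setT (fun w : T => ((w : H), omega l.+1 w)).
  by apply: measurable_fun_pair.
pose pair : {mfun T >-> (H * R)%type} := HB.pack (fun w : T => ((w : H),
  omega l.+1 w)) (isMeasurableFun.Build _ _ _ _ _ mpair).
pose f (z : H * R) := (a z.1 + b z.1 * z.2 + c z.1 * z.2 ^+ 2)%:E.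
have mf : measurable_fun setT f.
  apply/measurable_EFinP; apply: measurable_funD; last first.
    apply: measurable_funM; first exact: measurableT_comp.
    by apply: measurable_funX; exact: measurable_snd.
  apply: measurable_funD; first exact: measurableT_comp.
  by apply: measurable_funM; [exact: measurableT_comp|exact: measurable_snd].
have f0 z : (0 <= f z)%E by rewrite lee_fin.
transitivity (\int[distribution P pair]_z f z)%E.
  by rewrite ge0_integral_distribution.
transitivity (\int[distribution P idH \x distribution P (omega l.+1)]_z f z)%E.
  apply: eq_measure_integral => A mA _.
  apply/esym; apply: product_measure_unique => // B C mB mC.
  exact: (indep_history omega_indep mB mC).
rewrite fubini_tonelli1//.
transitivity (\int[distribution P idH]_w (a w + c w)%:E)%E.
  apply: eq_integral => w _; rewrite /fubini_F /f /=.
  by apply: distribution_quadratic; exact: omega_std.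
rewrite ge0_integral_distribution//.
  by apply/measurable_EFinP; exact: measurable_funD.
move=> w; rewrite lee_fin.
(* The values of the quadratic at 1 and -1 average to [a w + c w]. *)
have := ge0 w 1; have := ge0 w (-1); lra.
Qed.

End Conditioning.

(** * First passage and the maximal inequality *)

Section Below.
Context (R : realType) (S : Type).

(** The value at time [l] itself is not tested, so [below t N l.+1] is already known at time [l]. *)
Fixpoint below (t : R) (N : nat -> S -> R) (l : nat) (w : S) : bool :=
  if l is k.+1 then below t N k w && (N k w < t) else true.

Lemma belowP t N l w : below t N l w -> forall k, (k < l)%N -> N k w < t.
Proof.
elim: l => // l IH /= /andP[/IH H Nl] k; rewrite ltnS leq_eqVlt.
by case/predU1P => [->//|]; exact: H.
Qed.

End Below.

Lemma measurable_below (R : realType) d (S : measurableType d)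
    (N : nat -> S -> R) t l :
  (forall k, (k < l)%N -> measurable_fun setT (N k)) ->
  measurable_fun setT (below t N l).
Proof.
elim: l => [|l IH] mN; first exact: measurable_cst.
apply: measurable_and; first by apply: IH => k kl; apply: mN; exact: ltnW.
by apply: measurable_fun_ltr => //; exact: mN.
Qed.

Section Maximal.
Context (R : realType) (d : measure_display) (T : measurableType d).
Context (P : probability T R) (omega : nat -> {RV P >-> R}).

(* The conditional mean of [V] given omega_1, ..., omega_l is [a + c], so the
   last clause is the conditional bound [E(V | history) <= q U]. *)
Definition quadratic_step (l : nat) (q : R) (U V : T -> R) : Prop :=
  exists a b c : T -> R,
  [/\ [/\ measurable_fun setT (a : history omega l -> R),
          measurable_fun setT (b : history omega l -> R) &
          measurable_fun setT (c : history omega l -> R)],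
      (forall w, V w = a w + b w * omega l.+1 w + c w * omega l.+1 w ^+ 2),
      (forall w y, 0 <= a w + b w * y + c w * y ^+ 2) &
      (forall w, a w + c w <= q * U w)].

Lemma quadratic_stepD l q U V U' V' :
  quadratic_step l q U V -> quadratic_step l q U' V' ->
  quadratic_step l q (U \+ U') (V \+ V').
Proof.
move=> [a [b [c [[ma mb mc] VE ge0 le]]]] [a' [b' [c' [[ma' mb' mc'] VE' ge0'
  le']]]].
exists (a \+ a'), (b \+ b'), (c \+ c'); split.
- by split; exact: measurable_funD.
- by move=> w /=; rewrite VE VE'; ring.
- by move=> w y /=; have := ge0 w y; have := ge0' w y; lra.
- by move=> w /=; have := le w; have := le' w; lra.
Qed.

(** After the passage time the process is frozen at the level [t], not at the value reached. This
    drop preserves the conditional bound, and a constant is trivially quadratic in the next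
    variable. *)
Definition stopped (t : R) (N : nat -> T -> R) (l : nat) (w : T) : R :=
  if below t N l w then N l w else t.

Variable N : nat -> T -> R.
Variables (q : nat -> R) (n : nat).
Hypothesis N_ge0 : forall l w, 0 <= N l w.
Hypothesis q_ge1 : forall l, 1 <= q l.
Hypothesis mN : forall k l, (k <= l <= n)%N ->
  measurable_fun setT (N k : history omega l -> R).
Hypothesis N_step : forall l,
  (l < n)%N -> quadratic_step l (q l) (N l) (N l.+1).

Lemma stopped_step t l : 0 <= t -> (l < n)%N ->
  quadratic_step l (q l) (stopped t N l) (stopped t N l.+1).
Proof.
move=> t0 ln.
have [a [b [c [[ma mb mc] VE ge0 le]]]] := N_step ln.
have mB : measurable_fun setT (below t N l.+1 : history omega l -> bool).
  by apply: measurable_below => k kl; apply: mN; rewrite -ltnS kl ltnW.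
exists (fun w => if below t N l.+1 w then a w else t),
  (fun w => if below t N l.+1 w then b w else 0),
  (fun w => if below t N l.+1 w then c w else 0); split.
- by split; apply: measurable_fun_ifT.
- by move=> w; rewrite /stopped; case: ifP => // _; rewrite !mul0r !addr0.
- by move=> w y; case: ifP => // _; rewrite !mul0r !addr0.
- move=> w; have q1 := q_ge1 l; rewrite /stopped /=;
    case: (below t N l w) => /=; last nra.
  (* At the passage time the next value is [t], which is at most [N l w], and the factor [q l] is at
     least 1. *)
  by case: ltP => // tN; nra.
Qed.

Lemma measurable_stopped t l : (l <= n)%N ->
  measurable_fun setT (stopped t N l : history omega l -> R).
Proof.
move=> ln; apply: measurable_fun_ifT.
- by apply: measurable_below => k kl; apply: mN; rewrite ln ltnW.
- by apply: mN; rewrite leqnn.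
- exact: measurable_cst.
Qed.

Lemma stopped_ge0 t l w : 0 <= t -> 0 <= stopped t N l w.
Proof. by rewrite /stopped; case: ifP. Qed.

Hypothesis omega_indep : mutually_independent [set l : nat | (0 < l)%N] omega.
Hypothesis omega_std : forall l, (0 < l)%N -> standardized (omega l).

Lemma integral_quadratic_step l p (U V : T -> R) : 0 <= p ->
  measurable_fun setT U -> (forall w, 0 <= U w) -> quadratic_step l p U V ->
  (\int[P]_w (V w)%:E <= p%:E * \int[P]_w (U w)%:E)%E.
Proof.
move=> p0 mU U0 [a [b [c [[ma mb mc] VE ge0 le]]]].
under eq_integral do rewrite VE.
rewrite (integral_next_quadratic omega_indep omega_std ma mb mc ge0).
rewrite -ge0_integralZl_EFin//; last 2 first.
  by move=> w _; rewrite lee_fin.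
  exact/measurable_EFinP.
apply: ge0_le_integral => //.
- by move=> w _; rewrite lee_fin; have := ge0 w 1; have := ge0 w (-1); lra.
- apply/measurable_EFinP; apply: (@measurable_fun_history _ _ _ _ omega l).
  exact: measurable_funD.
- by apply/measurable_EFinP; exact: measurable_funM.
- by move=> w _; rewrite -EFinM lee_fin.
Qed.

(** Stated for a general process [W] because it serves both [N] and its stopped version. *)
Lemma integral_iterated_step (W : nat -> T -> R) l : (l <= n)%N ->
  (forall k, (k <= n)%N -> measurable_fun setT (W k)) ->
  (forall k w, 0 <= W k w) ->
  (forall k, (k < n)%N -> quadratic_step k (q k) (W k) (W k.+1)) ->
  (\int[P]_w (W l w)%:E <= (\prod_(k < l) q k)%:E * \int[P]_w (W 0 w)%:E)%E.
Proof.
move=> ln mW W0 stepW; elim: l ln => [|l IH] ln;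
  first by rewrite big_ord0 mul1e.
have ql : 0 <= q l by exact: le_trans (q_ge1 l).
apply: le_trans (integral_quadratic_step ql (mW _ (ltnW ln)) (W0 l) (stepW _
  ln)) _.
rewrite big_ord_recr /= mulrC EFinM -muleA.
by apply: lee_wpmul2l => //; exact: IH (ltnW ln).
Qed.

Variable K : R.
Hypothesis N0 : forall w, N 0 w = K.

Lemma mean_bound l : (l <= n)%N ->
  (\int[P]_w (N l w)%:E <= ((\prod_(k < l) q k) * K)%:E)%E.
Proof.
move=> ln; rewrite EFinM -(integral_cst_probability P K).
have -> : (\int[P]__ K%:E = \int[P]_w (N 0 w)%:E)%E.
  by apply: eq_integral => w _; rewrite N0.
apply: integral_iterated_step => // k kn.
by apply: (@measurable_fun_history _ _ _ _ omega k); apply: mN; rewrite leqnn.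
Qed.

(** Markov's inequality for the stopped process at time [n]: off the event its value is at least
    [t], while its mean is at most the product of the factors times [K]. *)
Lemma maximal_bound t : 0 < t ->
  measurable (below t N n.+1 : set T) /\
  ((1 - (\prod_(k < n) q k) * K / t)%:E <= P (below t N n.+1))%E.
Proof.
move=> t0; set A := (below t N n.+1 : set T).
have mA : measurable A.
  apply: (@measurable_history _ _ _ _ omega n).
  have mb : measurable_fun setT (below t N n.+1 : history omega n -> bool).
    by apply: measurable_below => k kl; apply: mN; rewrite -ltnS kl leqnn.
  have := mb measurableT [set true]; rewrite setTI preimage_true; exact.
split=> //.
have mAc : measurable (~` A) by exact: measurableC.
have := @integral_iterated_step (stopped t N) n (leqnn n) _ _ _.
have /[swap]/[apply] : forall k : nat, (k <=
  n)%N -> measurable_fun [set: T] (stopped t N k).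
  move=> k kn; apply: (@measurable_fun_history _ _ _ _ omega k).
  exact: measurable_stopped.
have /[swap]/[apply] : forall k w, 0 <= stopped t N k w.
  by move=> k w; apply: stopped_ge0; exact: ltW.
have /[swap]/[apply] : forall k,
  (k < n)%N -> quadratic_step k (q k) (stopped t N k) (stopped t N k.+1).
  by move=> k kn; apply: stopped_step => //; exact: ltW.
rewrite /stopped /=.
under [X in (_ <= _ * X)%E]eq_integral do rewrite N0.
rewrite integral_cst_probability -EFinM => le.
have le2 : (t%:E * P (~` A) <= (\prod_(k < n) q k * K)%:E)%E.
  apply: le_trans le.
  rewrite -(setIT (~` A)) -integral_indic// -ge0_integralZl_EFin//;
    last 2 first.
    by apply/measurable_EFinP; exact: measurable_indic.
    exact: ltW.
  apply: ge0_le_integral => //.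
  - by move=> w _; rewrite mule_ge0 ?lee_fin// ltW.
  - by apply/measurable_EFinP; apply: measurable_funM => //;
      exact: measurable_indic.
  - apply/measurable_EFinP; apply: (@measurable_fun_history _ _ _ _ omega n).
    exact: measurable_stopped.
  - move=> w _; rewrite -EFinM lee_fin indicE.
    have [wA|wA] := boolP (w \in ~` A); last first.
      by rewrite mulr0; case: ifP => // _; exact: ltW.
    rewrite mulr1; case: ifP => // bl; move: wA; rewrite inE /A /= bl /=.
    by move/negP; rewrite -leNgt.
have := probability_setC P mA.
have [p pE] : exists p, P A = p%:E by exists (fine (P A));
  rewrite fineK// fin_num_measure.
rewrite pE => PC; rewrite PC -EFinB -EFinM lee_fin in le2.
rewrite lee_fin lerBlDr -lerBlDl ler_pdivlMr// mulrC.
by [].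
Qed.

End Maximal.

(** * Energy of the transfer cocycle *)

Section Energy.
Context (R : realType).
Implicit Types (E h y k : R) (v : nat -> R) (u : R * R) (l m j : nat).

(** The pair (psi_(l+1), psi_l) of the recurrence at energy E + h z, as polynomials in z. The
    initial pairs (1, 0) and (0, 1) give the two columns of M_l. *)
Fixpoint solution E h v u l : {poly R} * {poly R} :=
  if l is k.+1 then
    let s := solution E h v u k in
    (((E - v l)%:P + h *: 'X) * s.1 - s.2, s.1)
  else (u.1%:P, u.2%:P).

Definition shiftc (p : {poly R}) j : R := if j is i.+1 then p`_i else 0.

Lemma solution_coefS E h v u l j :
  (solution E h v u l.+1).1`_j =
    (E - v l.+1) * (solution E h v u l).1`_j + h * shiftc (solution E h v u
      l).1 j
      - (solution E h v u l).2`_j.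
Proof.
rewrite /= coefB mulrDl coefD coefCM -scalerAl coefZ coefXM.
by case: j.
Qed.

Lemma size_solution E h v u l :
  (size (solution E h v u l).1 <= l.+1)%N /\ (size (solution E h v u l).2 <=
    l.+1)%N.
Proof.
elim: l => [|l [IH1 IH2]] /=; first by rewrite !size_polyC; do 2 case: eqP.
split; last exact: leqW.
apply: leq_trans (size_polyD _ _) _;
  rewrite geq_max size_polyN (leqW IH2) andbT.
have s2 : (size ((E - v l.+1)%:P + h *: 'X : {poly R})%R <= 2)%N.
  apply: leq_trans (size_polyD _ _) _; rewrite geq_max size_polyC.
  rewrite (leq_trans (size_scale_leq _ _)) ?size_polyX// andbT.
  by case: eqP.
apply: leq_trans (size_polyMleq _ _) _.
by rewrite -subn1 leq_subLR add1n -addn2 addnC leq_add.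
Qed.

Definition form E (a b : R) : R := a ^+ 2 - E * a * b + b ^+ 2.

(** The difference is |E| / 2 times the square of a - b or a + b, according to the sign of E. *)
Lemma form_lower E a b : (1 - `|E| / 2) * (a ^+ 2 + b ^+ 2) <= form E a b.
Proof.
rewrite /form; case: (ger0P E) => E0.
  by have := mulr_ge0 E0 (sqr_ge0 (a - b)); lra.
have E0' : 0 <= - E by lra.
by have := mulr_ge0 E0' (sqr_ge0 (a + b)); lra.
Qed.

Lemma form_ge0 E a b : `|E| <= 2 -> 0 <= form E a b.
Proof.
move=> E2; apply: le_trans (form_lower E a b).
by apply: mulr_ge0; [lra|rewrite addr_ge0 ?sqr_ge0].
Qed.

Definition energy E m (s : {poly R} * {poly R}) : R :=
  \sum_(j < m) form E s.1`_j s.2`_j.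

Lemma energy_ge0 E m (s : {poly R} * {poly R}) : `|E| <= 2 -> 0 <= energy E m s.
Proof. by move=> E2; apply: sumr_ge0 => j _; exact: form_ge0. Qed.

Lemma energy_lower E m (s : {poly R} * {poly R}) :
  (1 - `|E| / 2) * \sum_(j < m) (s.1`_j ^+ 2 + s.2`_j ^+ 2) <= energy E m s.
Proof. by rewrite mulr_sumr; apply: ler_sum => j _; exact: form_lower. Qed.

(** Together with [energy_b] and [energy_c]: the coefficients of 1, y, y^2 in the energy after one
    step with potential value [k * y]. *)
Definition energy_a E h m (s : {poly R} * {poly R}) : R :=
  \sum_(j < m) (form E s.1`_j s.2`_j
    + h * shiftc s.1 j * (E * s.1`_j - 2 * s.2`_j) + h ^+ 2 * shiftc s.1 j ^+
        2).
Definition energy_b E h k m (s : {poly R} * {poly R}) : R :=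
  \sum_(j < m) (- k * (s.1`_j * (E * s.1`_j - 2 * s.2`_j)
    + 2 * h * s.1`_j * shiftc s.1 j)).
Definition energy_c k m (s : {poly R} * {poly R}) : R :=
  \sum_(j < m) (k ^+ 2 * s.1`_j ^+ 2).

(* [form E] is invariant under [T(E)], so only the perturbation contributes. *)
Lemma energy_step E h k m (s : {poly R} * {poly R}) y :
  \sum_(j < m) form E ((E - k * y) * s.1`_j + h * shiftc s.1 j - s.2`_j) s.1`_j
    =
  energy_a E h m s + energy_b E h k m s * y + energy_c k m s * y ^+ 2.
Proof.
rewrite /energy_a /energy_b /energy_c !mulr_suml -!big_split /=.
by apply: eq_bigr => j _; rewrite /form; ring.
Qed.

Lemma sum_shiftc m (p : {poly R}) :
  \sum_(j < m) shiftc p j ^+ 2 <= \sum_(j < m) p`_j ^+ 2.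
Proof.
case: m => [|m]; first by rewrite !big_ord0.
rewrite big_ord_recl /= expr0n add0r [leRHS]big_ord_recr /=.
by rewrite lerDl sqr_ge0.
Qed.

(** The cross term costs at most [h * (S + 2 * (A + B))]. Multiplication by ['X] does not increase
    the truncated sum of squares, so [S <= A], and positivity of the form gives [A + B <= N / dl].
    The 3 is 1 + 2. *)
Lemma energy_growth E h k m (s : {poly R} * {poly R}) (dl : R) : 0 <=
  h -> 0 < dl -> dl <= 1 - `|E| / 2 ->
  energy_a E h m s + energy_c k m s
    <= (1 + (3 * h + h ^+ 2 + k ^+ 2) / dl) * energy E m s.
Proof.
move=> h0 dl0 dlE.
have E2 : `|E| <= 2 by lra.
set N := energy E m s.
set A := \sum_(j < m) s.1`_j ^+ 2; set B := \sum_(j < m) s.2`_j ^+ 2.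
set S := \sum_(j < m) shiftc s.1 j ^+ 2.
have SA : S <= A by exact: sum_shiftc.
have A0 : 0 <= A by apply: sumr_ge0 => j _; exact: sqr_ge0.
have B0 : 0 <= B by apply: sumr_ge0 => j _; exact: sqr_ge0.
have AB : dl * (A + B) <= N.
  apply: le_trans (energy_lower E m s); rewrite big_split /=.
  by rewrite ler_wpM2r// addr_ge0.
have AN : A + B <= N / dl by rewrite ler_pdivlMr// mulrC.
have -> : energy_c k m s = k ^+ 2 * A by rewrite /energy_c -mulr_sumr.
have aE : energy_a E h m s <= N + h * (S + 2 * (A + B)) + h ^+ 2 * S.
  rewrite /N /energy /S /A /B -big_split /= [2 * _]mulr_sumr -big_split /=.
  rewrite !mulr_sumr -!big_split /=; apply: ler_sum => j _.
  set p := s.1`_j; set q := s.2`_j; set t := shiftc _ _.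
  rewrite lerD2r lerD2l -mulrA ler_wpM2l//.
  (* With u = E p - 2 q: t u <= t^2 + u^2 / 4 and u^2 <= 8 (p^2 + q^2). *)
  have h1 := sqr_ge0 (2 * t - (E * p - 2 * q)).
  have h2 : (E * p - 2 * q) ^+ 2 <= 8 * (p ^+ 2 + q ^+ 2).
    have EE : E ^+ 2 <= 4 by rewrite -[E ^+ 2]real_normK ?num_real//;
      have := normr_ge0 E; nra.
    have := sqr_ge0 (E * p + 2 * q); have := sqr_ge0 p; nra.
  nra.
have h20 : 0 <= h ^+ 2 by exact: sqr_ge0.
have k20 : 0 <= k ^+ 2 by exact: sqr_ge0.
have AN' : A <= N / dl by lra.
have -> : (1 + (3 * h + h ^+ 2 + k ^+ 2) / dl) * N =
  N + h * (3 * (N / dl)) + h ^+ 2 * (N / dl) + k ^+ 2 * (N / dl) by ring.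
apply: le_trans (lerD aE (lexx _)) _.
apply: lerD; last by rewrite ler_wpM2l.
apply: lerD; last by rewrite ler_wpM2l//; lra.
by rewrite lerD2l ler_wpM2l//; lra.
Qed.

End Energy.

(** * Coupling constants and the sum of their squares *)

Section Coupling.
Context (R : realType).

(** Bernoulli's inequality, or the weighted mean inequality for x and 1: the tangent of ln at [m]
    bounds p ln x + (1 - p) ln 1. *)
Lemma powR_le_tangent (x p : R) : 0 < x -> 0 < p -> p <= 1 ->
  x `^ p <= 1 + p * (x - 1).
Proof.
move=> x0 p0 p1; set m := 1 + p * (x - 1).
have m0 : 0 < m by rewrite /m; nra.
have lnV (y : R) : 0 < y -> ln y - ln m <= y / m - 1.
  move=> y0; rewrite -ln_div ?posrE//.
  have := @le_ln1Dx R (y / m - 1); rewrite subrKC; apply.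
  by have : 0 < y / m by [exact: divr_gt0]; lra.
rewrite -ler_ln ?posrE ?powR_gt0// ln_powR.
have h1 := lnV x x0; have h2 := lnV 1 ltr01; rewrite ln1 in h2.
have h3 : p * (ln x - ln m) <= p * (x / m - 1) by rewrite ler_wpM2l// ltW.
have h4 : (1 - p) * (0 - ln m) <= (1 - p) * (1 / m - 1).
  by rewrite ler_wpM2l//; lra.
have : p * (x / m - 1) + (1 - p) * (1 / m - 1) = 0.
  rewrite [LHS](_ : _ = m / m - 1); first by rewrite divff ?subrr// gt_eqF.
  by rewrite /m; ring.
lra.
Qed.

(** Comparison with the integral of x^(p-1) over [0, n]. The induction step n^p <= (n+1)^p (1 -
    p/(n+1)) is Bernoulli's inequality at n/(n+1). *)
Lemma sum_powR_le (p : R) n : 0 < p -> p <= 1 ->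
  \sum_(i < n) i.+1%:R `^ (p - 1) <= n%:R `^ p / p.
Proof.
move=> p0 p1; elim: n => [|n IH].
  by rewrite big_ord0 divr_ge0 ?powR_ge0// ltW.
rewrite big_ord_recr /=; apply: le_trans (lerD IH (lexx _)) _.
have S0 : 0 < n.+1%:R :> R by rewrite ltr0n.
have -> : n.+1%:R `^ (p - 1) = n.+1%:R `^ p / n.+1%:R :> R.
  by rewrite powRB ?powRr1 ?ltW// (gt_eqF S0) implybT.
set y : R := n.+1%:R `^ p; have y0 : 0 < y by exact: powR_gt0.
suff np : n%:R `^ p <= y * (1 - p / n.+1%:R).
  rewrite (_ : y / p = (y * (1 - p / n.+1%:R)) / p + y / n.+1%:R).
    by rewrite lerD2r ler_pM2r// invr_gt0.
  by field; rewrite !gt_eqF.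
case: n {IH} => [|n] in S0 y y0 *.
  by rewrite powR0 ?gt_eqF// mulr_ge0//; [exact: ltW|rewrite divr1; lra].
have n0 : 0 < n.+1%:R :> R by rewrite ltr0n.
have -> : n.+1%:R = n.+2%:R * (n.+1%:R / n.+2%:R) :> R.
  by field; rewrite gt_eqF.
rewrite powRM; [|exact: ltW|by rewrite divr_ge0 ?ltW].
rewrite -/y ler_pM2l//.
apply: le_trans (powR_le_tangent _ p0 p1) _; first exact: divr_gt0.
by rewrite [n.+2%:R]mulrS le_eqVlt; apply/orP; left; apply/eqP; field;
  rewrite -mulrS gt_eqF.
Qed.

Variables (sigma eta : R).
Hypotheses (eta_gt0 : 0 < eta) (eta_le : eta <= 2^-1).

Definition coupling n l : R :=
  sigma / (n%:R `^ eta * (n.+1 - l)%:R `^ (2^-1 - eta)).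

Lemma potentialE om n l : potential sigma eta om n l = coupling n l * om l.
Proof. by rewrite /potential /coupling mulrA mulrAC. Qed.

Lemma powR_sqr (x p : R) : (x `^ p) ^+ 2 = x `^ (2 * p).
Proof. by rewrite -powR_mulrn ?powR_ge0// -powRrM mulrC. Qed.

(** In reversed order the squared couplings are sigma^2 n^(-2 eta) l^(2 eta - 1). Their sum grows
    like n^(2 eta), which the normalization cancels. *)
Lemma sum_coupling_le n :
  \sum_(l < n) coupling n l.+1 ^+ 2 <= sigma ^+ 2 / (2 * eta).
Proof.
case: n => [|n]; first by rewrite big_ord0; apply: divr_ge0;
  [exact: sqr_ge0|rewrite mulr_ge0 ?ltW].
have -> : \sum_(l < n.+1) coupling n.+1 l.+1 ^+ 2 =
   sigma ^+ 2 / n.+1%:R `^ (2 * eta) * \sum_(l < n.+1) l.+1%:R `^ (2 * eta - 1).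
  rewrite (reindex_inj rev_ord_inj) /= mulr_sumr; apply: eq_bigr => l _.
  rewrite /coupling !(subSS, subKn) ?ltn_ord// exprMn exprVn exprMn !powR_sqr.
  rewrite (_ : 2 * (2^-1 - eta) = - (2 * eta - 1)); last by lra.
  rewrite powRN; field.
  by rewrite !gt_eqF// powR_gt0// ltr0n.
have n0 : 0 < n.+1%:R `^ (2 * eta) :> R by rewrite powR_gt0// ltr0n.
have e0 : 0 < 2 * eta by rewrite mulr_gt0.
have e1 : 2 * eta <= 1 by have := eta_le; lra.
apply: le_trans (ler_wpM2l _ (@sum_powR_le (2 * eta) n.+1 e0 e1)) _.
  by rewrite divr_ge0 ?sqr_ge0// ltW.
rewrite le_eqVlt; apply/orP; left; apply/eqP; field.
by rewrite !gt_eqF.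
Qed.

End Coupling.

(** * The energy along the random potential *)

Section RandomEnergy.
Context (R : realType) (d : measure_display) (T : measurableType d).
Context (P : probability T R) (omega : nat -> {RV P >-> R}).
Variables (sigma eta : R).

(** For [l <= n] the degrees are at most [n], so keeping [n.+1] coefficients loses nothing, and one
    truncation serves all times. *)
Definition energies (E h : R) (n l : nat) (v : nat -> R) : R :=
  energy E n.+1 (solution E h v (1, 0) l) + energy E n.+1 (solution E h v (0,
    1) l).

Definition random_potential (n : nat) (w : T) : nat -> R :=
  potential sigma eta (fun l => omega l w) n.

Variables (E h : R) (n : nat).

Lemma measurable_solution_coef u k l j : (k <= l)%N ->
  measurable_fun setT
    (fun w : history omega l =>
      (solution E h (random_potential n w) u k).1`_j) /\
  measurable_fun setT
    (fun w : history omega l => (solution E h (random_potential n w) u k).2`_j).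
Proof.
elim: k j => [|k IH] j kl; first by split=> /=; exact: measurable_cst.
split; last exact: (IH j (ltnW kl)).1.
under eq_fun do rewrite solution_coefS /random_potential potentialE.
apply: measurable_funB; last exact: (IH j (ltnW kl)).2.
apply: measurable_funD.
  apply: measurable_funM; last exact: (IH j (ltnW kl)).1.
  apply: measurable_funB; first exact: measurable_cst.
  apply: measurable_funM; first exact: measurable_cst.
  exact: measurable_omega_history.
apply: measurable_funM; first exact: measurable_cst.
case: j => [|j]; first exact: measurable_cst.
exact: (IH j (ltnW kl)).1.
Qed.

Lemma measurable_solution_shiftc u k l j : (k <= l)%N ->
  measurable_fun setT
    (fun w : history omega l =>
      shiftc (solution E h (random_potential n w) u k).1 j).
Proof.
case: j => [|j] kl; first exact: measurable_cst.
exact: (measurable_solution_coef u j kl).1.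
Qed.

Lemma measurable_energy u k l : (k <= l)%N ->
  measurable_fun setT
    (fun w : history omega l =>
      energy E n.+1 (solution E h (random_potential n w) u k)).
Proof.
move=> kl; apply: measurable_sum => j.
have [m1 m2] := measurable_solution_coef u j kl.
apply: measurable_funD; last exact: measurable_funX.
apply: measurable_funB; first exact: measurable_funX.
by do 2![apply: measurable_funM => //].
Qed.

Lemma energy_quadratic_step u l (dl : R) : 0 <= h -> 0 < dl -> dl <=
  1 - `|E| / 2 ->
  quadratic_step omega l (1 +
    (3 * h + h ^+ 2 + coupling sigma eta n l.+1 ^+ 2) / dl)
    (fun w => energy E n.+1 (solution E h (random_potential n w) u l))
    (fun w => energy E n.+1 (solution E h (random_potential n w) u l.+1)).
Proof.
move=> h0 dl0 dlE; set k := coupling _ _ _ _.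
pose s w := solution E h (random_potential n w) u l.
exists (fun w => energy_a E h n.+1 (s w)), (fun w => energy_b E h k n.+1 (s w)),
  (fun w => energy_c k n.+1 (s w)); split.
- split; apply: measurable_sum => j.
  + have [m1 m2] := measurable_solution_coef u j (leqnn l).
    have m3 := measurable_solution_shiftc u j (leqnn l).
    apply: measurable_funD; last first.
      by apply: measurable_funM => //; exact: measurable_funX.
    apply: measurable_funD; last first.
      apply: measurable_funM; first by apply: measurable_funM.
      by apply: measurable_funB; apply: measurable_funM.
    apply: measurable_funD; last exact: measurable_funX.
    apply: measurable_funB; first exact: measurable_funX.
    by do 2![apply: measurable_funM => //].
  + have [m1 m2] := measurable_solution_coef u j (leqnn l).
    have m3 := measurable_solution_shiftc u j (leqnn l).
    apply: measurable_funM => //; apply: measurable_funD.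
      by apply: measurable_funM => //; apply: measurable_funB;
        apply: measurable_funM.
    by do 2![apply: measurable_funM => //].
  + have [m1 m2] := measurable_solution_coef u j (leqnn l).
    by apply: measurable_funM => //; exact: measurable_funX.
- move=> w; rewrite -energy_step /energy; apply: eq_bigr => j _.
  by rewrite solution_coefS {1}/random_potential potentialE.
- move=> w y; rewrite -energy_step; apply: sumr_ge0 => j _.
  by apply: form_ge0; lra.
- by move=> w; exact: energy_growth.
Qed.

End RandomEnergy.

Section EnergyBounds.
Context (R : realType) (d : measure_display) (T : measurableType d).
Context (P : probability T R) (omega : nat -> {RV P >-> R}).
Variables (sigma eta : R).
Hypotheses (eta_gt0 : 0 < eta) (eta_le : eta <= 2^-1).
Hypothesis omega_indep : mutually_independent [set l : nat | (0 < l)%N] omega.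
Hypothesis omega_std : forall l, (0 < l)%N -> standardized (omega l).

(** The initial energy 2 times the exponential of the growth rates summed over all steps, for
    [h * n <= s]; independent of [n]. *)
Definition energy_bound (s dl : R) : R :=
  expR ((3 * s + s ^+ 2 + sigma ^+ 2 / (2 * eta)) / dl) * 2.

Variables (E s dl : R) (n : nat).
Hypotheses (s_ge0 : 0 <= s) (dl_gt0 : 0 < dl) (dlE : dl <= 1 - `|E| / 2).
Hypothesis n_gt0 : (0 < n)%N.

Let N h l w := energies E h n l (random_potential omega sigma eta n w).
Let q h l := 1 + (3 * h + h ^+ 2 + coupling sigma eta n l.+1 ^+ 2) / dl.

Lemma energies_ge0 h l v : 0 <= energies E h n l v.
Proof. have E2 : `|E| <= 2 by have := dl_gt0; have := dlE; lra.
by rewrite /energies addr_ge0// energy_ge0. Qed.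

Lemma energies0 h v : energies E h n 0 v = 2.
Proof.
rewrite /energies /energy !big_ord_recl !big1 /form /=; last 2 first.
- by move=> i _; rewrite !coefC /=; ring.
- by move=> i _; rewrite !coefC /=; ring.
by rewrite !coefC /=; ring.
Qed.

Let q_ge1 h l : 0 <= h -> 1 <= q h l.
Proof.
move=> h0; rewrite lerDl; apply: divr_ge0; last exact: ltW.
by rewrite !addr_ge0 ?sqr_ge0// mulr_ge0.
Qed.

Let prod_q h l : 0 <= h -> h * n%:R <= s -> (l <= n)%N ->
  (\prod_(k < l) q h k) * 2 <= energy_bound s dl.
Proof.
move=> h0 hs ln; rewrite ler_pM2r//.
apply: (@le_trans _ _ (\prod_(k < n) q h k)).
  rewrite -(big_mkord xpredT (q h)) -(big_mkord xpredT (q h))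
    [leRHS](@big_cat_nat _ _ _ l)//=.
  rewrite ler_peMr//.
    by apply: prodr_ge0 => i _; exact: le_trans (q_ge1 _ h0).
  by apply: (big_ind (fun x => 1 <= x)) => // [x y x1 y1|i _];
    [nra|exact: q_ge1].
apply: (@le_trans _ _ (expR (\sum_(k < n) (3 * h + h ^+ 2 + coupling sigma eta
  n k.+1 ^+ 2) / dl))).
  rewrite expR_sum; apply: ler_prod => i _.
  by rewrite (le_trans _ (q_ge1 _ h0))// expR_ge1Dx.
rewrite ler_expR -mulr_suml ler_pM2r ?invr_gt0//.
rewrite big_split /= lerD ?sum_coupling_le//.
rewrite sumr_const card_ord -[leLHS]mulr_natr mulrDl.
have n1 : 1 <= n%:R :> R by rewrite ler1n.
(* Hence n h^2 <= s^2, the quadratic term of the exponent. *)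
have hh : h <= s by have := hs; nra.
have := s_ge0.
nra.
Qed.

Let measurable_N h k l : (k <= l <= n)%N ->
  measurable_fun setT (N h k : history omega l -> R).
Proof.
by move=> /andP[kl ln]; apply: measurable_funD; exact: measurable_energy.
Qed.

Let step_N h l : 0 <=
  h -> (l < n)%N -> quadratic_step omega l (q h l) (N h l) (N h l.+1).
Proof.
by move=> h0 ln; apply: quadratic_stepD; apply: energy_quadratic_step.
Qed.

Lemma mean_energies h l : 0 <= h -> h * n%:R <= s -> (l <= n)%N ->
  (\int[P]_w (energies E h n l (random_potential omega sigma eta n w))%:E
    <= (energy_bound s dl)%:E)%E.
Proof.
move=> h0 hs ln.
apply: le_trans (mean_bound (N := N h) (q := q h) (n := n) (K :=
  2) _ _ _ _ omega_indep omega_std _ ln) _.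
- by move=> *; exact: energies_ge0.
- by move=> k; exact: q_ge1.
- by move=> k m; exact: measurable_N.
- by move=> k; exact: step_N.
- by move=> w; exact: energies0.
- by rewrite lee_fin prod_q.
Qed.

Lemma max_energies h t : 0 <= h -> h * n%:R <= s -> 0 < t ->
  exists A : set T, [/\ measurable A,
    ((1 - energy_bound s dl / t)%:E <= P A)%E &
    forall w, A w -> forall l, (l <= n)%N ->
      energies E h n l (random_potential omega sigma eta n w) < t].
Proof.
move=> h0 hs t0.
have [mA PA] := maximal_bound (N := N h) (q := q h) (n := n) (K := 2)
  (fun _ _ => energies_ge0 _ _ _) (fun k => q_ge1 k h0) (@measurable_N h)
  (fun k => @step_N h k h0) omega_indep omega_std (fun _ => energies0 _ _) t0.
exists (below t (N h) n.+1 : set T); split => //.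
  apply: le_trans PA; rewrite lee_fin lerD2l lerN2 ler_pM2r ?invr_gt0//.
  exact: prod_q.
by move=> w bw l ln; apply: (belowP bw); rewrite ltnS.
Qed.

End EnergyBounds.

(** * Transfer matrices *)

Section SquaredModulus.
Context (R : realType).
Implicit Types (z w : R[i]) (x : R).

(** Takes values in [R], unlike the norm of [R[i]], so that real arithmetic applies directly. *)
Definition sqmod z : R := let: a +i* b := z in a ^+ 2 + b ^+ 2.

Lemma sqmodE z : (sqmod z)%:C = `|z| ^+ 2.
Proof. by rewrite -add_Re2_Im2; case: z. Qed.

Lemma sqmod_ge0 z : 0 <= sqmod z.
Proof. by case: z => a b; rewrite addr_ge0 ?sqr_ge0. Qed.

Lemma sqmodM z w : sqmod (z * w) = sqmod z * sqmod w.
Proof. by case: z w => [a b] [c e]; rewrite /sqmod /=; ring. Qed.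

Lemma sqmod_real x : sqmod x%:C = x ^+ 2.
Proof. by rewrite /sqmod /= expr0n addr0. Qed.

Lemma sqmod0 : sqmod 0 = 0.
Proof. by rewrite (sqmod_real 0) expr0n. Qed.

Lemma sqmod1 : sqmod 1 = 1.
Proof. by rewrite (sqmod_real 1) expr1n. Qed.

Lemma sqmod_prod (I : Type) (r : seq I) (p : pred I) (f : I -> R[i]) :
  sqmod (\prod_(i <- r | p i) f i) = \prod_(i <- r | p i) sqmod (f i).
Proof. exact: (big_morph _ sqmodM sqmod1). Qed.

Lemma sqmod_le z x : `|z| <= x%:C -> sqmod z <= x ^+ 2.
Proof.
move=> zx; have x0 : 0 <= x by rewrite -ler0c; exact: le_trans (normr_ge0 z) zx.
by rewrite -lecR sqmodE rmorphXn lerXn2r// nnegrE ?normr_ge0// ler0c.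
Qed.

(** Peel off the constant term: |a_0 + z y|^2 <= 2 a_0^2 + 2 |z y|^2, and by induction |z y|^2 is at
    most half the sum of the remaining squares. *)
Lemma sqmod_sum_le m (a : nat -> R) z : sqmod z <= 4^-1 ->
  sqmod (\sum_(j < m) (a j)%:C * z ^+ j) <= 2 * \sum_(j < m) a j ^+ 2.
Proof.
move=> z4; elim: m a => [|m IH] a; first by rewrite !big_ord0 sqmod0 mulr0.
rewrite !big_ord_recl expr0 mulr1.
set s := \sum_(i < m) _; set u := \sum_(i < m) _.
have -> : s = z * \sum_(j < m) (a j.+1)%:C * z ^+ j.
  by rewrite mulr_sumr; apply: eq_bigr => j _; rewrite lift0 exprS mulrCA.
have -> : u = \sum_(j < m) a j.+1 ^+ 2 by apply: eq_bigr.
have := IH (fun j => a j.+1); set y := \sum_(j < m) _;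
  set S := \sum_(j < m) _ => yS.
have zy : sqmod (z * y) <= S / 2.
  have := sqmod_ge0 y; rewrite sqmodM; nra.
move: zy; rewrite /sqmod; case: (z * y) => b e /=.
have := sqr_ge0 (a 0%N - b); have := sqr_ge0 e; nra.
Qed.

(** Lagrange's identity: the defect is the squared modulus of the inner product of the two
    columns. *)
Lemma lagrange_sqmod (a b c e : R[i]) :
  sqmod (a * e - b * c) <= (sqmod a + sqmod c) * (sqmod b + sqmod e).
Proof.
rewrite -subr_ge0.
rewrite [leRHS](_ : _ = sqmod (a * b^* + c * e^*)) ?sqmod_ge0//.
by case: a b c e => [a1 a2] [b1 b2] [c1 c2] [e1 e2]; rewrite /sqmod /=; ring.
Qed.

Lemma trace_sqmod (M : 'M[R[i]]_2) :
  \tr (M *m M ^t*) = (sqmod (M 0 0) + sqmod (M 1 0) +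
    (sqmod (M 0 1) + sqmod (M 1 1)))%:C.
Proof.
have sE z : (sqmod z)%:C = z * Num.conj z by rewrite sqmodE normCK.
rewrite /mxtrace !big_ord_recl big_ord0 !mxE !big_ord_recl !big_ord0 !mxE.
rewrite (_ : lift ord0 ord0 = 1 :> 'I_2); last exact/val_inj.
rewrite !rmorphD /= !sE; ring.
Qed.

End SquaredModulus.

(** * Transfer matrices, polynomial solutions and eigenvectors *)

Section Transfer.
Context (R : realType).
Variables (sigma eta : R) (om : nat -> R) (E : R) (n : nat).

Let v := potential sigma eta om n.

Lemma transferS lam l c :
  (transfer sigma eta om E n lam l.+1 0 c =
     (E%:C + lam / (rho E * n%:R)%:C - (v l.+1)%:C) * transfer sigma eta om E n
       lam l 0 c
       - transfer sigma eta om E n lam l 1 c) *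
  (transfer sigma eta om E n lam l.+1 1 c =
    transfer sigma eta om E n lam l 0 c).
Proof.
rewrite /= !mxE !big_ord_recl !big_ord0 !mxE /=.
rewrite (_ : lift ord0 ord0 = 1 :> 'I_2); last exact/val_inj.
by split; rewrite /epsilon -/v; ring.
Qed.

Lemma det_transfer lam l :
  transfer sigma eta om E n lam l 0 0 * transfer sigma eta om E n lam l 1 1
    - transfer sigma eta om E n lam l 0 1 * transfer sigma eta om E n lam l 1 0
        = 1.
Proof.
elim: l => [|l IH]; first by rewrite /= !mxE /= mul1r mulr0 subr0.
by rewrite -[RHS]IH !transferS; ring.
Qed.

Lemma transfer_columns lam l :
  let M := transfer sigma eta om E n lam l in
  1 <= (sqmod (M 0 0) + sqmod (M 1 0)) * (sqmod (M 0 1) + sqmod (M 1 1)).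
Proof.
rewrite /=; apply: le_trans (lagrange_sqmod _ _ _ _).
by rewrite det_transfer sqmod1.
Qed.

(** Writing lam = s z turns the energy shift lam / (rho n) into h z. The scale [s] is free, to be
    chosen so that z stays in a small disc. *)
Lemma transfer_solution (s : R) (z : R[i]) l :
  let h := s / (rho E * n%:R) in
  let val (p : {poly R}) := (map_poly (real_complex R) p).[z] in
  let M := transfer sigma eta om E n (s%:C * z) l in
  [/\ M 0 0 = val (solution E h v (1, 0) l).1, M 1 0 = val (solution E h v (1,
    0) l).2,
      M 0 1 = val (solution E h v (0, 1) l).1 & M 1 1 = val (solution E h v (0,
        1) l).2].
Proof.
move=> h val; elim: l => [|l [IH1 IH2 IH3 IH4]]; cbv zeta.
  by rewrite /= !mxE /val /= !map_polyC !hornerC.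
have valS u : val (solution E h v u l.+1).1 =
  (E%:C + s%:C * z / (rho E * n%:R)%:C - (v l.+1)%:C) * val (solution E h v u
  l).1 - val (solution E h v u l).2.
  rewrite /val /= rmorphB rmorphM rmorphD /= map_polyC map_polyZ map_polyX.
  rewrite !hornerE /=; congr (_ * _ - _).
  by rewrite /h !rmorphB /= fmorph_div; ring.
by rewrite !transferS !valS IH1 IH2 IH3 IH4.
Qed.

Lemma sqmod_horner (p : {poly R}) m z : (size p <= m)%N -> sqmod z <= 4^-1 ->
  sqmod (map_poly (real_complex R) p).[z] <= 2 * \sum_(j < m) p`_j ^+ 2.
Proof.
move=> pm z4; rewrite (@horner_coef_wide _ m) ?size_map_poly//.
rewrite (eq_bigr (fun j : 'I_m => (p`_j)%:C * z ^+ j)); last first.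
  by move=> j _; rewrite coef_map.
exact: (sqmod_sum_le _ (fun j => p`_j)).
Qed.

(** The right side does not involve [z], so one event for the energies controls a whole disc of
    spectral parameters. *)
Lemma transfer_energies (s dl : R) (z : R[i]) l : (l <= n)%N ->
  sqmod z <= 4^-1 -> 0 < dl -> dl <= 1 - `|E| / 2 ->
  let M := transfer sigma eta om E n (s%:C * z) l in
  dl * (sqmod (M 0 0) + sqmod (M 1 0) + (sqmod (M 0 1) + sqmod (M 1 1)))
    <= 2 * energies E (s / (rho E * n%:R)) n l v.
Proof.
move=> ln z4 dl0 dlE /=; set h := s / _.
have [-> -> -> ->] := transfer_solution s z l; rewrite -/h.
have col u : dl * (sqmod (map_poly (real_complex R) (solution E h v u l).1).[z]
  +
    sqmod (map_poly (real_complex R) (solution E h v u l).2).[z]) <=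
      2 * energy E n.+1 (solution E h v u l).
  have [s1 s2] := size_solution E h v u l.
  have h1 := sqmod_horner (leq_trans s1 (ln : (l.+1 <= n.+1)%N)) z4.
  have h2 := sqmod_horner (leq_trans s2 (ln : (l.+1 <= n.+1)%N)) z4.
  have := energy_lower E n.+1 (solution E h v u l).
  rewrite big_split /=; move: h1 h2.
  set A := \sum_(j < _) _; set B := \sum_(j < _) _.
  have A0 : 0 <= A by apply: sumr_ge0 => j _; exact: sqr_ge0.
  have B0 : 0 <= B by apply: sumr_ge0 => j _; exact: sqr_ge0.
  move=> h1 h2 h3; apply: le_trans (ler_wpM2l (ltW dl0) (lerD h1 h2)) _.
  rewrite -mulrDr mulrCA ler_pM2l//; apply: le_trans h3.
  by rewrite ler_wpM2r// addr_ge0.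
by rewrite mulrDr /energies [2 * (_ + _)]mulrDr lerD.
Qed.

Lemma site0 (psi : 'cV[R[i]]_n) : site psi 0 = 0.
Proof. by rewrite /site big_pred0. Qed.

Lemma site_last (psi : 'cV[R[i]]_n) : site psi n.+1 = 0.
Proof. by rewrite /site big_pred0// => i; rewrite eqSS ltn_eqF. Qed.

(** Since psi_0 = 0, only the first column of the transfer matrix acts. *)
Lemma eigenvector_transfer (psi : 'cV[R[i]]_n) (mu : R) (lam : R[i]) l :
  schrodinger sigma eta om n *m psi = mu%:C *: psi ->
  E%:C + lam / (rho E * n%:R)%:C = mu%:C -> (l <= n)%N ->
  let M := transfer sigma eta om E n lam l in
  site psi l.+1 = M 0 0 * site psi 1 /\ site psi l = M 1 0 * site psi 1.
Proof.
move=> Hpsi lamE; elim: l => [|l IH] ln.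
  by rewrite /= !mxE /= mul1r mul0r site0.
have [IH1 IH2] := IH (ltnW ln).
cbv zeta; rewrite !transferS; split => //.
have := congr1 (fun u : 'cV[R[i]]_n => u (Ordinal ln) 0) Hpsi.
rewrite schrodingerE mxE -site_ord /= -/v => eqn.
rewrite lamE mulrBl -mulrA -IH1 mulrBl.
rewrite -IH2 -eqn; ring.
Qed.

(** Every site is counted twice, because the two boundary values vanish. *)
Lemma sum_site (psi : 'cV[R[i]]_n) : l2_normalized psi ->
  \sum_(l < n.+1) (sqmod (site psi l) + sqmod (site psi l.+1)) = 2.
Proof.
move=> psi1; have psi1' : \sum_(i < n) sqmod (psi i 0) = 1.
  apply: (@complexI R); rewrite rmorph_sum rmorph1 /= -psi1.
  by apply: eq_bigr => i _; exact: sqmodE.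
rewrite big_split /= big_ord_recl site0 sqmod0 add0r big_ord_recr /=
  site_last sqmod0 addr0.
rewrite -[2]/(1 + 1) -{1}psi1' -psi1'; congr (_ + _); apply: eq_bigr => i _.
  by rewrite /bump add1n site_ord.
by rewrite site_ord.
Qed.

(** The squared norm c_l of the first column lies between 1/t and t. Since the c_l |psi_1|^2 sum to
    2, |psi_1|^2 lies between 2/((n+1)t) and 2t/(n+1); a second use of the bounds on c_l gives the
    claim. *)
Lemma eigenvector_profile (psi : 'cV[R[i]]_n) (mu t : R) (lam : R[i]) :
  schrodinger sigma eta om n *m psi = mu%:C *: psi -> l2_normalized psi ->
  E%:C + lam / (rho E * n%:R)%:C = mu%:C ->
  (forall l, (l <= n)%N -> let M := transfer sigma eta om E n lam l in
     \tr (M *m M ^t*) < t%:C) ->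
  forall l, (l <= n)%N ->
  2 / (n.+1%:R * t ^+ 2) < sqmod (site psi l) + sqmod (site psi l.+1) < 2 * t
    ^+ 2 / n.+1%:R.
Proof.
move=> Hpsi psi1 lamE trt.
pose c l := sqmod (transfer sigma eta om E n lam l 0 0) + sqmod (transfer sigma
  eta om E n lam l 1 0).
pose x := sqmod (site psi 1).
have x0 : 0 <= x by exact: sqmod_ge0.
have n0 : 0 < n.+1%:R :> R by rewrite ltr0n.
have cP l : (l <= n)%N -> [/\ 0 < t, c l < t & 1 < t * c l].
  move=> ln; have := trt l ln; cbv zeta; rewrite trace_sqmod ltcR -/(c l).
  have := transfer_columns lam l; rewrite /= -/(c l).
  have : 0 <= c l by rewrite addr_ge0 ?sqmod_ge0.
  set c' := sqmod _ + _; have : 0 <= c' by rewrite addr_ge0 ?sqmod_ge0.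
  move=> c'0 c0 cc' cct; split; nra.
have t0 : 0 < t by have [] := cP 0%N isT.
have uE l : (l <= n)%N -> sqmod (site psi l) + sqmod (site psi l.+1) = c l * x.
  move=> ln; have [-> ->] := eigenvector_transfer Hpsi lamE ln.
  by rewrite !sqmodM -mulrDl addrC.
have Su : \sum_(l < n.+1) c l * x = 2.
  by rewrite -(sum_site psi1); apply: eq_bigr => l _; rewrite uE// -ltnS.
have xpos : 0 < x.
  rewrite lt_neqAle x0 andbT; apply/negP => /eqP x00.
  by move: Su; rewrite big1 => [/eqP|l _];
    rewrite -?x00 ?mulr0// eq_sym pnatr_eq0.
have Sle : 2 < n.+1%:R * (t * x).
  rewrite -Su mulr_natl -[X in _ *+ X]card_ord -sumr_const.
  apply: ltr_sum => [|l _]; first by apply/hasP; exists ord0;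
    rewrite ?mem_index_enum.
  by rewrite ltr_pM2r//; have [] := cP l (ltn_ord l).
have Sge : n.+1%:R * x < 2 * t.
  rewrite -Su mulr_suml mulr_natl -[X in _ *+ X]card_ord -sumr_const.
  apply: ltr_sum => [|l _]; first by apply/hasP; exists ord0;
    rewrite ?mem_index_enum.
  by have [_ _] := cP l (ltn_ord l); nra.
move=> l ln; rewrite uE//; have [_ c1 c2] := cP l ln.
rewrite ltr_pdivrMr ?mulr_gt0 ?exprn_gt0// ltr_pdivlMr//; apply/andP; split.
  apply: lt_le_trans Sle _.
  rewrite (_ : c l * x * _ = (n.+1%:R * (t * x)) * (t * c l)); last by ring.
  by rewrite ler_peMr ?mulr_ge0 ?ltW.
rewrite (_ : c l * x * _ = (n.+1%:R * x) * c l); last by ring.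
rewrite (_ : 2 * t ^+ 2 = (2 * t) * t); last by ring.
have c0 : 0 <= c l by rewrite addr_ge0 ?sqmod_ge0.
by rewrite ltr_pM// mulr_ge0 ?ltW.
Qed.

End Transfer.

Section Rho.
Context (R : realType).
Variables (E dl : R).
Hypotheses (dl_gt0 : 0 < dl) (dlE : dl <= 1 - `|E| / 2).

(** The number x = 1 - E^2/4 lies between [dl] and 1, so its square root is at least x. *)
Lemma rho_bounds : 1 <= rho E <= dl^-1.
Proof.
have := dl_gt0; have := dlE; rewrite /rho => h1 h2.
have e0 : 0 <= `|E| by [].
have -> : E ^+ 2 = `|E| ^+ 2 by rewrite real_normK ?num_real.
set x := 1 - _; have x1 : x <= 1 by rewrite /x; nra.
have dx : dl <= x by rewrite /x; nra.
have x0 : 0 < x by lra.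
have sx : Num.sqrt x <= 1 by rewrite -[leRHS]sqrtr1 ler_wsqrtr.
have sx0 : 0 < Num.sqrt x by rewrite sqrtr_gt0.
have xx : Num.sqrt x ^+ 2 = x by rewrite sqr_sqrtr// ltW.
rewrite invf_ge1// sx /= lef_pV2 ?posrE//; nra.
Qed.

Lemma rho_gt0 : 0 < rho E.
Proof. by have /andP[+ _] := rho_bounds; apply: lt_le_trans. Qed.

End Rho.

Section MaximalInequality.
Context (R : realType) (d : measure_display) (T : measurableType d).
Context (P : probability T R) (omega : nat -> {RV P >-> R}) (sigma eta : R).
Hypotheses (eta_gt0 : 0 < eta) (eta_le : eta <= 2^-1).
Hypothesis omega_indep : mutually_independent [set l : nat | (0 < l)%N] omega.
Hypothesis omega_std : forall l, (0 < l)%N -> standardized (omega l).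

Lemma transfer_maximal (E r : R) : -2 < E < 2 ->
  exists2 c : R, 0 < c & forall t : R, 0 < t -> forall n, (0 < n)%N ->
    exists A : set T, [/\ measurable A, ((1 - c / t)%:E <= P A)%E &
      forall w, A w -> forall (l : nat) (lam : R[i]), (l <= n)%N -> `|lam| <=
        r%:C ->
        let M := transfer sigma eta (fun l => omega l w) E n lam l in
        \tr (M *m M ^t*) < t%:C].
Proof.
move=> E2; pose dl := 1 - `|E| / 2.
have dl0 : 0 < dl by rewrite /dl; move: E2; case: (ger0P E); lra.
(* The factor 2 puts lam / s in the disc of radius 1/2; the added 1 keeps [s] positive. *)
pose s := 2 * (`|r| + 1); have s0 : 0 < s by rewrite /s; have := normr_ge0 r;
  lra.
pose G := energy_bound sigma eta s dl.
have G0 : 0 < G by rewrite mulr_gt0// expR_gt0.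
exists (2 * G / dl); first by rewrite divr_gt0// mulr_gt0.
move=> t t0 n n0; have nR : 0 < n%:R :> R by rewrite ltr0n.
have rho0 := rho_gt0 dl0 (lexx dl).
have /andP[rho1 _] := rho_bounds dl0 (lexx dl).
have h0 : 0 <= s / (rho E * n%:R) by rewrite divr_ge0 ?mulr_ge0 ?ltW.
have hs : s / (rho E * n%:R) * n%:R <= s.
  rewrite (_ : _ * n%:R = s / rho E); last by field; rewrite !gt_eqF.
  by rewrite ler_pdivrMr// ler_peMr// ltW.

(* The trace is at most 2 / dl times the energy, so this level for the energies yields [t] for the
   trace. *)
have t'0 : 0 < t * dl / 2 by rewrite divr_gt0// mulr_gt0.
have [A [mA PA HA]] := max_energies sigma eta_gt0 eta_le omega_indep omega_std
  (ltW s0) dl0 (lexx dl) n0 h0 hs t'0.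
exists A; split => //.
  rewrite (_ : 2 * G / dl / t = G / (t * dl / 2))//.
  by field; rewrite !gt_eqF.
move=> w Aw l lam ln lamr; cbv zeta; rewrite trace_sqmod ltcR.
have sC : s%:C != 0 :> R[i] by rewrite eq_complex /= gt_eqF.
pose z := lam / s%:C.
have z4 : sqmod z <= 4^-1.
  have := sqmod_le lamr; rewrite /z => lr.
  have : sqmod lam = sqmod z * s ^+ 2 by rewrite -sqmod_real -sqmodM divfK.
  have rs : 4 * r ^+ 2 <= s ^+ 2.
    have -> : r ^+ 2 = `|r| ^+ 2 by rewrite real_normK ?num_real.
    by rewrite /s; have := normr_ge0 r; nra.
  rewrite -(ler_pM2r (exprn_gt0 2 s0)) -/z; lra.
have := transfer_energies sigma eta (fun l => omega l w) s ln z4 dl0 (lexx dl).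
cbv zeta; rewrite (_ : s%:C * z = lam); last by rewrite mulrC divfK.
have := HA w Aw l ln; rewrite /random_potential.
set e := energies _ _ _ _ _ => he.
rewrite -(ltr_pM2l dl0) => le; apply: le_lt_trans le _; lra.
Qed.

End MaximalInequality.

(** * Counting eigenvalues *)

Section Spectrum.
Context (R : realType).

(** In diagonalizing coordinates the eigenspace is supported on the indices with entry [a]. It thus
    factors through the coordinate projection [J], whose rank is at most their number. *)
Lemma rank_eigenspace_diag n (P : 'M[R[i]]_n) (e : 'rV[R[i]]_n) (a : R[i]) :
  P \in unitmx ->
  (\rank (eigenspace (invmx P *m diag_mx e *m P) a) <= #|[pred i | e 0%R i ==
    a]|)%N.
Proof.
move=> Pu; set A := _ *m P; set V := eigenspace A a.
have /eqP VA : V *m A == a *: V by apply/eqP/eigenspaceP.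
have [B BV] : exists B, B = V *m invmx P by exists (V *m invmx P).
have BD : B *m diag_mx e = a *: B.
  have := congr1 (mulmx^~ (invmx P)) VA.
  by rewrite /A !mulmxA mulmxK// -scalemxAl BV.
pose J : 'M[R[i]]_n := \sum_(i in [pred i | e 0%R i == a]) delta_mx i i.
have BJ : B = B *m J.
  apply/matrixP => i j; rewrite mulmx_sumr summxE.
  rewrite (eq_bigr (fun k => B i k * (j == k)%:R)); last first.
    move=> k _; rewrite mxE (bigD1 k)//= big1 ?addr0 => [|l lk].
      by rewrite [delta_mx _ _ _ _]mxE eqxx.
    by rewrite [delta_mx _ _ _ _]mxE (negPf lk) mulr0.
  have := congr1 (fun M : 'M[R[i]]_n => M i j) BD;
    rewrite mul_mx_diag !mxE => Bij.
  have [ja|ja] := boolP (j \in [pred i | e 0%R i == a]).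
    rewrite (bigD1 j)//= eqxx mulr1 big1 ?addr0// => k /andP[_ kj].
    by rewrite eq_sym (negPf kj) mulr0.
  rewrite big1 => [|k ka]; last first.
    by case: eqP => [jk|]; [move: ja; rewrite jk ka|rewrite mulr0].
  apply/eqP; move: ja; rewrite inE; apply: contraNT => Bn0.
  by rewrite -(inj_eq (mulfI Bn0)) Bij mulrC.
have -> : \rank V = \rank B by rewrite BV mxrankMfree// row_free_unit
  unitmx_inv.
rewrite BJ; apply: leq_trans (mxrankM_maxr _ _) _.
rewrite /J -sum1_card; elim/big_ind2: _ => [|A1 m1 A2 m2 h1 h2|i _].
- by rewrite mxrank0.
- exact: leq_trans (mxrank_add _ _) (leq_add h1 h2).
- by rewrite mxrank_delta.
Qed.

(** The sum over [D] reduces to the distinct entries lying in [D], and each index contributes to at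
    most one of them. *)
Lemma eigencount_diag n (P : 'M[R[i]]_n) (e : 'I_n -> R) (D : set R) :
  P \in unitmx ->
  (eigencount (invmx P *m diag_mx (\row_i (e i)%:C) *m P) D
    <= #|[pred i | `[< D (e i) >]]|)%N.
Proof.
move=> Pu; set A := _ *m P.
pose m (mu : R) := #|[pred i | e i == mu]|.
have rm mu : (\rank (eigenspace A mu%:C) <= m mu)%N.
  apply: leq_trans (rank_eigenspace_diag _ _ Pu) _.
  by apply/subset_leq_card/fintype.subsetP => i;
    rewrite !inE mxE (inj_eq (@complexI R)).
pose S := undup [seq e i | i <- enum 'I_n & `[< D (e i) >]].
have SP mu : mu \in S -> D mu.
  by rewrite mem_undup => /mapP[k]; rewrite mem_filter =>
    /andP[/asboolP De _] ->.
rewrite /eigencount (fsbigE S _ (undup_uniq _) SP); last first.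
  move=> mu Dmu muS; apply/eqP; rewrite -leqn0; apply: leq_trans (rm mu) _.
  rewrite leqn0; apply/eqP/eq_card0 => i; rewrite !inE.
  apply/negP => /eqP ei; move/negP: muS; apply.
  rewrite mem_undup; apply/mapP; exists i => //.
  by rewrite mem_filter mem_enum andbT; apply/asboolP; rewrite ei.
apply: (@leq_trans (\sum_(mu <- S) \sum_(k < n) (e k == mu))).
  rewrite big_mkcond /=; apply: leq_sum => mu _; case: ifP => // _.
  apply: leq_trans (rm mu) _; rewrite /m -sum1_card big_mkcond /=.
  by apply: leq_sum => k _; rewrite inE; case: eqP.
rewrite exchange_big -sum1_card [leqRHS]big_mkcond /=; apply: leq_sum => k _.
have -> : (\sum_(mu <- S) (e k == mu) = (e k \in S))%N.
  rewrite -(count_uniq_mem _ (undup_uniq _)) -sum1_count [RHS]big_mkcond.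
  by apply: eq_bigr => mu _; rewrite /= [mu == _]eq_sym; case: (_ == _).
rewrite inE; case: asboolP => [_|nD]; first by case: (_ \in _).
by case: (boolP (e k \in S)) => // /SP.
Qed.

Lemma schrodinger_diag (sigma eta : R) (om : nat -> R) n :
  exists (P : 'M[R[i]]_n) (e : 'I_n -> R), P \in unitmx /\
   schrodinger sigma eta om n = invmx P *m diag_mx (\row_i (e i)%:C) *m P.
Proof.
set H := schrodinger _ _ _ _.
have Hs : H \is symmetricmx.
  apply/is_hermitianmxP; rewrite expr0 scale1r; apply/matrixP => i j.
  rewrite !mxE /=; congr (_ + _); first exact: addrC.
  by case: (eqVneq i j) => [->|] //; rewrite !mulr0.
have Hr : H \is a realmx.
  apply/mxOverP => i j; rewrite mxE !rpredD ?rpredM ?realn//.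
  by apply/complex_realP; eexists.
have Hh := realsym_hermsym Hs Hr.
have := hermitian_spectral_diag_real Hh.
have /hermitian_normalmx /orthomx_spectralP HE := Hh.
move=> /mxOverP sr.
exists (spectralmx H), (fun i => complex.Re (spectral_diag H 0 i)); split.
  exact: spectral_unit.
rewrite [LHS]HE; congr (_ *m diag_mx _ *m _); apply/rowP => i; rewrite mxE.
by rewrite RRe_real//; exact: sr.
Qed.

End Spectrum.

(** * The characteristic polynomial as a transfer matrix entry *)

Section Determinant.
Context (R : realType).
Variables (sigma eta : R) (om : nat -> R) (E : R).

Lemma sqmodN1 : sqmod (-1 : R[i]) = 1.
Proof.
by rewrite (_ : -1 = (-1)%:C) ?sqmod_real ?sqrrN ?expr1n// rmorphN1.
Qed.

Lemma sqmod_sign k : sqmod ((-1 : R[i]) ^+ k) = 1.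
Proof.
elim: k => [|k IH]; first by rewrite expr0 sqmod1.
by rewrite exprS sqmodM IH sqmodN1 mulr1.
Qed.

Lemma transfer10 n lam l :
  transfer sigma eta om E n lam l 1 0 =
    if l is k.+1 then transfer sigma eta om E n lam k 0 0 else 0.
Proof. by case: l => [|l]; [rewrite /= !mxE|rewrite transferS]. Qed.

(* Replacing the first column of [z - H] by the image of the solution
   [u = (M_0 0 0, ..., M_(n-1) 0 0)] leaves the determinant unchanged, and turns
   that column into [M_n 0 0] times the last basis vector. *)
Lemma sqmod_det_schrodinger n lam :
  let z := E%:C + lam / (rho E * n%:R)%:C in
  sqmod (\det (z%:M - schrodinger sigma eta om n)) =
    sqmod (transfer sigma eta om E n lam n 0 0).
Proof.
move=> z; case: n => [|m] in z *.
  by rewrite det_mx00 /= mxE.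
pose n := m.+1; pose u l := transfer sigma eta om E n lam l 0 0.
set H := schrodinger _ _ _ _; pose A : 'M[R[i]]_n := z%:M - H.
pose psi : 'cV[R[i]]_n := \col_j u j.
pose V : 'M[R[i]]_n := \matrix_(j, k) if k == 0 then u j else (j == k)%:R.
have u0 : u 0%N = 1 by rewrite /u /= mxE.
have sitepsi l : site psi l.+1 = if (l < n)%N then u l else 0.
  case: ltnP => ln; last by rewrite /site big_pred0// => j;
    rewrite eqSS ltn_eqF// (leq_trans _ ln).
  by rewrite -[l]/(nat_of_ord (Ordinal ln)) site_ord mxE.
have Apsi (j : 'I_n) : (A *m psi) j 0 = if j == ord_max then u n else 0.
  rewrite mulmxBl [LHS]mxE [X in _ + X]mxE schrodingerE mul_scalar_mx [X in X +
    _]mxE.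
  have uS : u j.+1 = (z - (potential sigma eta om n j.+1)%:C) * u j - transfer
    sigma eta om E n lam j 1 0.
    by rewrite /u transferS.
  have sj : site psi j = transfer sigma eta om E n lam j 1 0.
    rewrite transfer10; case: {uS} j => -[|j] jn /=; first by rewrite site0.
    by rewrite sitepsi ltnW.
  rewrite sj !sitepsi ltn_ord mxE -[(j.+1 < n)%N]/(j < m)%N.
  case: eqP => [jm|/eqP jm].
    rewrite jm /= ltnn -/n.
    by move: uS; rewrite jm /= => ->; ring.
  have -> : (j < m)%N by rewrite ltn_neqAle -ltnS ltn_ord andbT.
  by rewrite uS; ring.
have detV : \det V = 1.
  rewrite det_trig; last first.
    apply/is_trig_mxP => j k jk; rewrite mxE.
    by case: eqP jk => [->//|_ jk]; rewrite (_ : (j == k) =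
      false)// -val_eqE /= ltn_eqF.
  by apply: big1 => j _; rewrite mxE; case: eqP => [->|_]; rewrite ?eqxx.
have AV (j k : 'I_n) : (A *m V) j k = if k == 0 then (A *m psi) j 0 else A j k.
  rewrite [LHS]mxE; case: eqP => [->|/eqP k0].
    by rewrite [RHS]mxE; apply: eq_bigr => i _; rewrite [V _ _]mxE [psi _ _]mxE.
  rewrite (bigD1 k)//= [V _ _]mxE (negPf k0) eqxx mulr1 big1 ?addr0// => i ik.
  by rewrite [V _ _]mxE (negPf k0) (negPf ik) mulr0.
rewrite -/A -[\det A]mulr1 -detV -det_mulmx (expand_det_col _ 0).
rewrite (bigD1 ord_max)//= big1 ?addr0; last first.
  by move=> j /negPf jm; rewrite AV eqxx Apsi jm mul0r.
rewrite AV eqxx Apsi eqxx sqmodM -[RHS]mulr1; congr (_ * _).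
rewrite /cofactor sqmodM sqmod_sign mul1r.
have AE (j k : 'I_n) : A j k = z * (j == k)%:R -
    ((j == k.+1 :> nat)%:R + (k == j.+1 :> nat)%:R +
      (potential sigma eta om n j.+1)%:C * (j == k)%:R).
  by rewrite !mxE !mulr_natr.
(* Without its last row and first column, the tridiagonal matrix becomes lower triangular with -1 on
   the diagonal. *)
rewrite det_trig; last first.
  apply/is_trig_mxP => j k jk; rewrite [LHS]mxE [LHS]mxE AV AE.
  rewrite -!val_eqE /= /bump /= leqNgt ltn_ord add0n add1n.
  have [j1 j2] : (j < k.+1)%N /\
    (j < k.+2)%N by rewrite !ltnS ltnW// (leqW (ltnW jk)).
  by rewrite (ltn_eqF j1) (ltn_eqF j2) eqSS eq_sym (ltn_eqF jk) !mulr0 !addr0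
    subrr.
rewrite sqmod_prod big1// => j _;
  rewrite [X in sqmod X]mxE [X in sqmod X]mxE AV AE.
rewrite -!val_eqE /= /bump /= leqNgt ltn_ord add0n add1n eqxx.
rewrite (ltn_eqF (ltnSn j)) (ltn_eqF (leqW (ltnSn j))) !mulr0 !addr0 !add0r.
by rewrite sqmodN1.
Qed.

End Determinant.

(** * From energies to the number of eigenvalues in the window *)

Section Counting.
Context (R : realType).
Variables (sigma eta : R) (om : nat -> R) (E : R) (n : nat) (r : R).
Hypotheses (n_gt0 : (0 < n)%N) (r_gt0 : 0 < r) (rho_pos : 0 < rho E).

Let H := schrodinger sigma eta om n.
Let y := r / (rho E * n%:R).
Let M k l := transfer sigma eta om E n ((k * r) *i) l.

Let y_gt0 : 0 < y.
Proof. by rewrite divr_gt0// mulr_gt0// ltr0n. Qed.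

Lemma spectral_point (k : R) : E%:C + ((k * r) *i) / (rho E * n%:R)%:C =
  E +i* (k * y).
Proof.
apply/eqP; rewrite -fmorphV eq_complex /=; apply/andP; split; apply/eqP.
  by rewrite !(mul0r, mulr0) subr0 addr0.
by rewrite /y; field; rewrite !gt_eqF// ltr0n.
Qed.

(** Up to modulus the entry is the product of E + i k y - e_j. When |E - e_j| < y, passing from k =
    1 to k = 3 multiplies the squared factor by at least 5; the other factors do not decrease. *)
Lemma eigencount_growth :
  5 ^+ eigencount H (window r E n) * sqmod (M 1 n 0 0) <= sqmod (M 3 n 0 0).
Proof.
have [P [e [Pu HE]]] := schrodinger_diag sigma eta om n.
have dE k : sqmod (M k n 0 0) = \prod_(j < n) ((E - e j) ^+ 2 + (k * y) ^+ 2).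
  rewrite -sqmod_det_schrodinger spectral_point HE.
  set z := E +i* _; rewrite (_ : z%:M - _ =
    invmx P *m diag_mx (\row_j (z - (e j)%:C)) *m P).
    rewrite !det_mulmx mulrAC -det_mulmx mulVmx// det1 mul1r det_diag
      sqmod_prod.
    by apply: eq_bigr => j _; rewrite mxE /sqmod /= oppr0 addr0.
  have -> : diag_mx (\row_j (z - (e j)%:C)) = z%:M - diag_mx (\row_j (e j)%:C).
    by apply/matrixP => j k'; rewrite !mxE mulrnBl.
  have zP : invmx P *m z%:M *m P =
    z%:M by rewrite scalar_mxC -mulmxA mulVmx// mulmx1.
  by rewrite mulmxBr mulmxBl zP.
rewrite !dE; set I := [pred j | `[< window r E n (e j) >]].
have KI : (eigencount H (window r E n) <= #|I|)%N by rewrite /H HE;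
  exact: eigencount_diag.
apply: (@le_trans _ _ (5 ^+ #|I| * \prod_(j < n) ((E - e j) ^+ 2 +
  (1 * y) ^+ 2))).
  rewrite ler_wpM2r//; last by rewrite ler_eXn2l// ltr1n.
  by apply: prodr_ge0 => j _; rewrite addr_ge0 ?sqr_ge0.
rewrite -prodr_const big_mkcond -big_split /=; apply: ler_prod => j _.
apply/andP; split; first by rewrite mulr_ge0 ?addr_ge0 ?sqr_ge0//; case: ifP.
case: ifP => [jI|_]; last by rewrite !mul1r lerD2l; have := sqr_ge0 y; lra.
have : window r E n (e j) by exact/asboolP.
rewrite /window /= in_itv /=.
rewrite [n%:R * _]mulrC -/y -subr_gt0 -[e j < _]subr_gt0 => /andP[h1 h2].
have := mulr_gt0 h1 h2; lra.
Qed.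

(** The imaginary part of [a * b^*]; on consecutive values it is the Wronskian of a solution and its
    conjugate. *)
Let cross (a b : R[i]) : R :=
  complex.Im a * complex.Re b - complex.Re a * complex.Im b.

(** Green's identity: the real potential cancels, and each step adds the imaginary part [y] of the
    energy times the squared modulus of the solution. *)
Lemma wronskian l : cross (M 1 l 0 0) (M 1 l 1 0) =
  y * \sum_(j < l) sqmod (M 1 j 0 0).
Proof.
elim: l => [|l IH].
  by rewrite big_ord0 /M /= !mxE /cross /= !mulr0 subrr.
rewrite big_ord_recr /=
  mulrDr -IH {1 2}/M !transferS -/(M 1 l) spectral_point mul1r.
case: (M 1 l 0 0) => a b; case: (M 1 l 1 0) => c e.
by rewrite /cross /sqmod /=; ring.
Qed.

Lemma cross_le a b : cross a b ^+ 2 <= sqmod a * sqmod b.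
Proof.
case: a b => [a1 a2] [b1 b2]; rewrite /cross /sqmod /= -subr_ge0.
by rewrite (_ : _ - _ = (a1 * b1 + a2 * b2) ^+ 2) ?sqr_ge0//; ring.
Qed.

Lemma harmonic_mean_le (e : nat -> R) m : (0 < m)%N -> (forall l,
  (l < m)%N -> 0 < e l) ->
  m%:R ^+ 2 <= (\sum_(l < m) (e l)^-1) * \sum_(l < m) e l.
Proof.
move=> m0 e0; set S := \sum_(l < m) e l.
have mR : 0 < m%:R :> R by rewrite ltr0n.
have S0 : 0 < S.
  rewrite /S; case: m m0 e0 {mR S} => // m _ e0;
    rewrite big_ord_recl ltr_pwDl ?e0//.
  by apply: sumr_ge0 => l _; rewrite ltW// e0// ltn_ord.
rewrite -ler_pdivrMr//.
(* tangent line of [1/x] at the mean [S/m] *)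
apply: (@le_trans _ _ (\sum_(l < m) (2 * (m%:R / S) - e l * (m%:R / S) ^+ 2))).
  rewrite sumrB sumr_const card_ord -mulr_suml -/S -[_ *+ m]mulr_natr.
  by rewrite le_eqVlt; apply/orP; left; apply/eqP; field; rewrite gt_eqF.
apply: ler_sum => l _; have el := e0 l (ltn_ord l); set x := m%:R / S.
rewrite -subr_ge0 (_ : _ - _ = e l * ((e l)^-1 - x) ^+ 2); last by field;
  rewrite gt_eqF.
by rewrite mulr_ge0 ?sqr_ge0// ltW.
Qed.

(** From k <= 5 (6/5)^k and (6/5)^8 <= 5 follows k^8 <= 5^8 5^k. *)
Lemma pow5_le k (x : R) : 0 <= x -> 5 ^+ k <= x ^+ 2 -> k%:R ^+ 4 <= 5 ^+ 4 * x.
Proof.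
move=> x0 kx.
have k1 : k%:R <= 5 * (6 / 5) ^+ k :> R.
  elim: k {kx} => [|k IH]; first by rewrite expr0; lra.
  have : 1 <= (6 / 5) ^+ k :> R by rewrite exprn_ege1//; lra.
  by rewrite exprS -[k.+1%:R]natr1; move: IH; set q := (6 / 5) ^+ k;
    set m := k%:R; lra.
have k8 : (k%:R ^+ 4) ^+ 2 <= (5 ^+ 4 * x) ^+ 2.
  rewrite -exprM; apply: (@le_trans _ _ ((5 * (6 / 5) ^+ k) ^+ 8)).
    by rewrite lerXn2r// nnegrE ?ler0n// mulr_ge0// exprn_ge0//; lra.
  have -> : (5 * (6 / 5) ^+ k) ^+ 8 = (5 ^+ 4) ^+ 2 * ((6 / 5) ^+ 8) ^+ k :> R.
    by rewrite exprMn -!exprM (mulnC k).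
  rewrite [leRHS]exprMn ler_pM2l ?exprn_gt0//; apply: le_trans kx.
  rewrite lerXn2r ?nnegrE ?exprn_ge0 ?divr_ge0//.
  by lra.
by rewrite -(@ler_pXn2r _ 2)// nnegrE ?exprn_ge0// mulr_ge0// exprn_ge0.
Qed.

Variables (dl : R).
Hypotheses (dl_gt0 : 0 < dl) (dlE : dl <= 1 - `|E| / 2).

(** With scale 6 r, the points lam = i k r with |k| <= 3 correspond to |z| <= 1/2, which covers k =
    1 and k = 3. *)
Let e l := energies E (6 * r / (rho E * n%:R)) n l (potential sigma eta om n).
Let mean := n%:R^-1 * \sum_(l < n) e l.

Lemma transfer_le_energies (k : R) l : `|k| <= 3 -> (l <= n)%N ->
  dl * (sqmod (M k l 0 0) + sqmod (M k l 1 0) +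
    (sqmod (M k l 0 1) + sqmod (M k l 1 1)))
   <= 2 * e l.
Proof.
move=> k3 ln; have /= :=
  @transfer_energies R sigma eta om E n (6 * r) dl ((k / 6) *i) l ln _ dl_gt0
  dlE.
have -> : (6 * r)%:C * ((k / 6) *i) = (k * r) *i.
  apply/eqP; rewrite eq_complex /=; apply/andP; split; apply/eqP; first by ring.
  by field.
apply; rewrite /sqmod expr0n add0r.
have : `|k| ^+ 2 = k ^+ 2 by rewrite real_normK ?num_real.
have := normr_ge0 k; nra.
Qed.

Lemma entries_le_energies (k : R) l : `|k| <= 3 -> (l <= n)%N ->
  dl * sqmod (M k l 0 0) <= 2 * e l /\ dl * sqmod (M k l 1 0) <= 2 * e l.
Proof.
move=> k3 ln; have le := transfer_le_energies k3 ln.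
have := sqmod_ge0 (M k l 0 0); have := sqmod_ge0 (M k l 1 0).
have := sqmod_ge0 (M k l 0 1); have := sqmod_ge0 (M k l 1 1) => h1 h2 h3 h4.
by split; apply: le_trans le; rewrite ler_pM2l//; lra.
Qed.

(** The squared norms of the two columns have product at least 1, and the energy bounds the second
    column from above. *)
Lemma solution_lower l : (l <= n)%N ->
  0 < e l /\ dl / (2 * e l) <= sqmod (M 1 l 0 0) + sqmod (M 1 l 1 0).
Proof.
move=> ln; have k3 : `|1| <= 3 :> R by rewrite normr1; lra.
have := transfer_le_energies k3 ln.
have := transfer_columns sigma eta om E n ((1 * r) *i) l; rewrite /= -/(M 1 l).
have : 0 <= sqmod (M 1 l 0 0) + sqmod (M 1 l 1 0) by rewrite addr_ge0
  ?sqmod_ge0.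
have : 0 <= sqmod (M 1 l 0 1) + sqmod (M 1 l 1 1) by rewrite addr_ge0
  ?sqmod_ge0.
set c := _ + _; set c' := _ + _ => c0 c'0 cc le.
have c'p : 0 < c' by nra.
have cp : 0 < c by nra.
have d0 := dl_gt0.
have ep : 0 < e l by nra.
split=> //; rewrite ler_pdivrMr ?mulr_gt0//.
have : dl * c <= 2 * e l by nra.
nra.
Qed.

(** The Wronskian bounds |f p|^2 from below, where f and p are the first-column entries at k = 1.
    Multiplying by 5^K replaces |f|^2 by its value at k = 3, and the energies bound that value and
    |p|^2 from above. *)
Lemma eigencount_energies :
  (eigencount H (window r E n))%:R ^+ 4 <=
    5 ^+ 4 * (8 / (r * dl ^+ 3) * (e n * mean)).
Proof.
have d0 := dl_gt0; have r0 := r_gt0.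
have nR : 0 < n%:R :> R by rewrite ltr0n.
have ep l : (l <= n)%N -> 0 < e l by move=> /solution_lower[].
have en := ep n (leqnn n).
have meanp : 0 < mean.
  rewrite /mean mulr_gt0 ?invr_gt0//; have := n_gt0.
  case: (n) ep => // m ep _; rewrite big_ord_recl ltr_pwDl ?ep//.
  by apply: sumr_ge0 => l _; rewrite ltW// ep// ltnW.
have x0 : 0 <= 8 / (r * dl ^+ 3) by rewrite divr_ge0// mulr_ge0 ?exprn_ge0//
  ltW.
apply: pow5_le; first by rewrite mulr_ge0// mulr_ge0// ltW.
have k1 : `|1| <= 3 :> R by rewrite normr1; lra.
have k3 : `|3| <= 3 :> R by rewrite ger0_norm.
have [_ dp1] := entries_le_energies k1 (leqnn n).
have [df3 _] := entries_le_energies k3 (leqnn n).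
set K := eigencount _ _.
pose S := \sum_(l < n) sqmod (M 1 l 0 0).
(* The lower entry at [l] is the upper entry at [l - 1], and it is 0 at [l = 0], so each upper entry
   is counted at most twice. *)
have Slow : \sum_(l < n) (sqmod (M 1 l 0 0) + sqmod (M 1 l 1 0)) <= 2 * S.
  rewrite big_split /= -/S mulr_natl mulr2n lerD2l.
  have := n_gt0; rewrite /S; case: (n) => // m _.
  rewrite big_ord_recl [leRHS]big_ord_recr /= {1}/M transfer10 sqmod0 add0r.
  rewrite (eq_bigr (fun l : 'I_m => sqmod (M 1 l 0 0)));
    first by rewrite lerDl sqmod_ge0.
  by move=> l _; rewrite /M transfer10.
have Shm : dl / 2 * \sum_(l < n) (e l)^-1 <= 2 * S.
  apply: le_trans Slow; rewrite mulr_sumr; apply: ler_sum => l _.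
  have [_] := solution_lower (ltnW (ltn_ord l)); apply: le_trans.
  by rewrite invfM mulrA.
have hm := @harmonic_mean_le e n n_gt0 (fun l ln => ep l (ltnW ln)).
have SeE : \sum_(l < n) e l = n%:R * mean.
  by rewrite /mean mulrA divff ?mul1r// gt_eqF.
have Smean : dl / 4 * n%:R <= S * mean.
  rewrite SeE in hm; set A := \sum_(l < n) _ in Shm hm.
  have d20 : 0 <= dl / 2 by lra.
  have h1 := ler_wpM2r (ltW (mulr_gt0 nR meanp)) Shm.
  have h2 := ler_wpM2l d20 hm.
  rewrite -(ler_pM2l nR); lra.
have W := wronskian n; rewrite -/S in W.
have /andP[_ rho_le] := rho_bounds dl_gt0 dlE.
(* The factor [n] in [Smean] cancels the one in [y], so the bound does not depend on the size. *)
have Wlow : r * dl ^+ 2 / 4 <= y * S * mean.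
  have h : y * (dl / 4 * n%:R) <= y * (S * mean) by rewrite ler_wpM2l// ltW.
  rewrite -[leRHS]mulrA; apply: le_trans h.
  rewrite (_ : y * _ = r * dl / 4 * (rho E)^-1); last first.
    by rewrite /y; field; rewrite !gt_eqF.
  have : dl <= (rho E)^-1 by rewrite -[dl]invrK lef_pV2// posrE invr_gt0.
  by move=> /(ler_wpM2l (ltW (mulr_gt0 r0 d0))); lra.
have := cross_le (M 1 n 0 0) (M 1 n 1 0); rewrite W => Wup.
have g := eigencount_growth; rewrite -/K in g.
move: Wup g.
set f1 := sqmod (M 1 n 0 0); set f3 := sqmod (M 3 n 0 0).
set p1 := sqmod (M 1 n 1 0) => Wup g.
have f30 : 0 <= f3 := sqmod_ge0 _; have p10 : 0 <= p1 := sqmod_ge0 _.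
have w0 : 0 <= r * dl ^+ 2 / 4 by rewrite divr_ge0// mulr_ge0 ?exprn_ge0// ltW.
have c1 : (r * dl ^+ 2 / 4) ^+ 2 <= (f1 * p1) * mean ^+ 2.
  apply: (@le_trans _ _ ((y * S * mean) ^+ 2)).
    by rewrite lerXn2r// nnegrE// (le_trans w0).
  by rewrite exprMn ler_wpM2r ?sqr_ge0.
have c2 : 5 ^+ K * (f1 * p1) * mean ^+ 2 <= f3 * p1 * mean ^+ 2.
  by rewrite ler_wpM2r ?sqr_ge0// mulrA ler_wpM2r.
have c3 : (dl * f3) * (dl * p1) <= (2 * e n) * (2 * e n).
  by rewrite ler_pM// mulr_ge0// ltW.
have K0 : 0 <= 5 ^+ K :> R by rewrite exprn_ge0.
have c4 : 5 ^+ K * (r * dl ^+ 2 / 4) ^+ 2 <= f3 * p1 * mean ^+ 2.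
  by apply: le_trans c2; rewrite -[leRHS]mulrA ler_wpM2l.
have c5 : dl ^+ 2 * (f3 * p1 * mean ^+ 2) <= (2 * e n) ^+ 2 * mean ^+ 2.
  rewrite (_ : dl ^+ 2 * _ = (dl * f3) * (dl * p1) * mean ^+ 2); last by ring.
  by rewrite ler_wpM2r ?sqr_ge0// expr2.
have c6 := le_trans (ler_wpM2l (sqr_ge0 dl) c4) c5.
rewrite (_ : (_ * (e n * mean)) ^+ 2 =
  ((2 * e n) ^+ 2 * mean ^+ 2) / (dl ^+ 2 * (r * dl ^+ 2 / 4) ^+ 2));
    last first.
  by field; rewrite !gt_eqF.
rewrite ler_pdivlMr;
  last by rewrite mulr_gt0 ?exprn_gt0 ?divr_gt0 ?mulr_gt0 ?exprn_gt0.
by rewrite mulrCA.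
Qed.

End Counting.

(** The integral of a nonnegative function is a supremum over the simple functions below it, hence
    monotone for arbitrary functions. This form applies to the eigenvalue count without a
    measurability proof. *)
Lemma nonneg_integral_mono (R : realType) d (T : measurableType d)
    (mu : {measure set T -> \bar R}) (f g : T -> \bar R) :
  (forall x, 0 <= f x)%E -> (forall x, f x <= g x)%E ->
  (\int[mu]_x f x <= \int[mu]_x g x)%E.
Proof.
move=> f0 fg; rewrite !ge0_integralTE//; last by move=> x;
  exact: le_trans (fg x).
apply: le_ereal_sup => _ [h hf <-]; exists h => // x.
exact: le_trans (fg x).
Qed.

(** Turns a bound on K^4 by a product of energies into a bound on K^2 by their sum, whose mean is
    controlled. Using q <= (1 + q)^2 avoids a square root. *)
Lemma square_bound (R : realFieldType) (q u v : R) : 0 <= q -> 0 <= u -> 0 <=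
  v ->
  5 ^+ 4 * (4 * q * (u * v)) <= (5 ^+ 2 * (1 + q) * (u + v)) ^+ 2.
Proof.
move=> q0 u0 v0.
have -> : (5 ^+ 2 * (1 + q) * (u + v)) ^+ 2 =
  5 ^+ 4 * ((1 + q) ^+ 2 * (u + v) ^+ 2) by ring.
rewrite ler_wpM2l ?exprn_ge0// (_ : 4 * q * (u * v) = q * (4 * (u * v)));
  last by ring.
apply: ler_pM => //; first by rewrite !mulr_ge0.
  by nra.
by have := sqr_ge0 (u - v); lra.
Qed.

(** * Mean of the eigenvalue count *)

Section MeanCount.
Context (R : realType) (d : measure_display) (T : measurableType d).
Context (P : probability T R) (omega : nat -> {RV P >-> R}) (sigma eta : R).
Hypotheses (eta_gt0 : 0 < eta) (eta_le : eta <= 2^-1).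
Hypothesis omega_indep : mutually_independent [set l : nat | (0 < l)%N] omega.
Hypothesis omega_std : forall l, (0 < l)%N -> standardized (omega l).

Definition count_bound (r dl : R) : R :=
  5 ^+ 2 * (1 + 2 / (r * dl ^+ 3)) * (2 * energy_bound sigma eta (6 * r) dl).

Lemma mean_eigencount (r dl E : R) n : 0 < r -> 0 < dl -> dl <= 1 - `|E| / 2 ->
  (0 < n)%N ->
  ('E_P[(fun w => (eigencount (schrodinger sigma eta (fun l => omega l w) n)
                   (window r E n))%:R `^ (3 / 2))%R] <=
                     (count_bound r dl)%:E)%E.
Proof.
move=> r0 dl0 dlE n0; have nR : 0 < n%:R :> R by rewrite ltr0n.
have rho0 := rho_gt0 dl0 dlE; have /andP[rho1 _] := rho_bounds dl0 dlE.
pose h := 6 * r / (rho E * n%:R).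
have r6 : 0 <= 6 * r by lra.
have h0 : 0 <= h by rewrite divr_ge0// mulr_ge0// ltW.
have hs : h * n%:R <= 6 * r.
  rewrite (_ : h * n%:R = 6 * r / rho E); last by rewrite /h; field;
    rewrite !gt_eqF.
  by rewrite ler_pdivrMr// ler_peMr.
pose e l w := energies E h n l (random_potential omega sigma eta n w).
pose mean w := n%:R^-1 * \sum_(l < n) e l w.
pose c : R := 5 ^+ 2 * (1 + 2 / (r * dl ^+ 3)).
have c0' : 0 < r * dl ^+ 3 by rewrite mulr_gt0 ?exprn_gt0.
have c0 : 0 <= c by rewrite mulr_ge0 ?exprn_ge0// addr_ge0// divr_ge0// ltW.
have e0 l w : 0 <= e l w by exact: (energies_ge0 _ dl0 dlE).
have mean0 w : 0 <= mean w by rewrite mulr_ge0 ?invr_ge0 ?ler0n// sumr_ge0.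
have me l : (l <= n)%N -> measurable_fun setT (e l).
  move=> ln; apply: (@measurable_fun_history _ _ _ _ omega l).
  by apply: measurable_funD; exact: measurable_energy.
have Ee l : (l <= n)%N -> (\int[P]_w (e l w)%:E <=
  (energy_bound sigma eta (6 * r) dl)%:E)%E.
  by move=> ln; apply: mean_energies.
rewrite unlock.
apply: (@le_trans _ _ (\int[P]_w (c%:E * ((e n w)%:E +
  (n%:R^-1)%:E * \sum_(l < n) (e l w)%:E)))%E).
  apply: nonneg_integral_mono => w; first by rewrite lee_fin powR_ge0.
  rewrite sumEFin -EFinM lee_fin -/(mean w).
  set K := eigencount _ _.
  apply: (@le_trans _ _ (K%:R ^+ 2)).
    case: K => [|K]; first by rewrite powR0 ?sqr_ge0// gt_eqF// divr_gt0.
    by rewrite -powR_mulrn// ler_powR ?ler1n//; lra.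
  have K4 : K%:R ^+ 4 <= 5 ^+ 4 * (8 / (r * dl ^+ 3) * (e n w * mean w)).
    exact: eigencount_energies.
  have en := e0 n w; have mw := mean0 w.
  rewrite -(@ler_pXn2r _ 2) ?nnegrE ?sqr_ge0//; last by apply: mulr_ge0 => //;
    exact: addr_ge0.
  rewrite -exprM; apply: le_trans K4 _.
  rewrite (_ : 8 / _ = 4 * (2 / (r * dl ^+ 3))); last by rewrite mulrA;
    congr (_ / _); ring.
  by apply: square_bound => //; rewrite divr_ge0// ltW.
have ms : measurable_fun setT (fun w => (\sum_(l < n) (e l w)%:E)%E).
  by apply: emeasurable_sum => l; apply/measurable_EFinP; apply: me;
    exact: ltnW.
rewrite ge0_integralZl_EFin//; last 2 first.
- by move=> w _; rewrite adde_ge0 ?lee_fin// mule_ge0 ?lee_fin ?invr_ge0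
    ?ler0n// sume_ge0// => l _; rewrite lee_fin.
- apply: emeasurable_funD; first by apply/measurable_EFinP; exact: me.
  exact: measurable_funeM.
have -> : (count_bound r dl)%:E =
  (c%:E * (2 * energy_bound sigma eta (6 * r) dl)%:E)%E.
  by rewrite -EFinM.
apply: lee_wpmul2l; first by rewrite lee_fin.
rewrite ge0_integralD//; last 4 first.
- by move=> w _; rewrite lee_fin.
- by apply/measurable_EFinP; exact: me.
- by move=> w _; rewrite mule_ge0 ?lee_fin ?invr_ge0 ?ler0n// sume_ge0// =>
    l _; rewrite lee_fin.
- exact: measurable_funeM.
rewrite mulr_natl mulr2n EFinD leeD ?Ee//.
rewrite ge0_integralZl_EFin ?invr_ge0 ?ler0n//; last first.
- by move=> w _; rewrite sume_ge0// => l _; rewrite lee_fin.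
rewrite ge0_integral_sum//; last 2 first.
- by move=> l; apply/measurable_EFinP; apply: me; exact: ltnW.
- by move=> l w _; rewrite lee_fin.
apply: (@le_trans _ _ ((n%:R^-1)%:E * \sum_(l < n) (energy_bound sigma eta (6 *
  r) dl)%:E)%E).
  by rewrite lee_wpmul2l ?lee_fin ?invr_ge0 ?ler0n//; apply: lee_sum => l _;
    apply: Ee; exact: ltnW.
by rewrite sumEFin -EFinM lee_fin sumr_const card_ord mulrnAr -mulrnAl -[_ *+
  n]mulr_natr mulVf ?mul1r ?gt_eqF.
Qed.

End MeanCount.

Theorem theorem1p2 (R : realType) (d : measure_display) (T : measurableType d)
    (P : probability T R) (omega : nat -> {RV P >-> R}) (sigma eta : R)
    (sigma_gt0 : 0 < sigma)
    (eta_gt0 : 0 < eta) (eta_le : eta <= 2^-1)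
    (omega_indep : mutually_independent [set l : nat | (0 < l)%N] omega)
    (omega_mean : forall l, (0 < l)%N -> ('E_P[omega l] = 0)%E)
    (omega_var : forall l, (0 < l)%N -> ('V_P[omega l] = 1)%E)
    (omega_third : exists K : R, forall l, (0 < l)%N ->
       ('E_P[(fun w => `|omega l w| ^+ 3)%R] <= K%:E)%E) :
  (forall E r : R, -2 < E < 2 ->
    exists2 c : R, 0 < c & forall t : R, 0 < t ->
      \forall n \near \oo, exists A : set T,
        [/\ measurable A,
            ((1 - c / t)%:E <= P A)%E &
            forall w, A w ->
              let om := fun l => omega l w in
              (forall (l : nat) (lam : R[i]), (l <= n)%N -> `|lam| <= r%:C ->
                 let M := transfer sigma eta om E n lam l in
                 \tr (M *m M ^t*) < t%:C)
              /\
              (forall (psi : 'cV[R[i]]_n) (mu : R),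
                 schrodinger sigma eta om n *m psi = mu%:C *: psi ->
                 l2_normalized psi ->
                 E - r / (rho E * n%:R) <= mu <= E + r / (rho E * n%:R) ->
                 forall l : nat, (l <= n)%N ->
                   (2 / (n.+1%:R * t ^+ 2))%:C
                     < `|site psi l| ^+ 2 + `|site psi l.+1| ^+ 2
                     < (2 * t ^+ 2 / n.+1%:R)%:C)])
  /\
  (forall r eps : R, 0 < r -> 0 < eps ->
    (ereal_sup [set ereal_sup
       [set 'E_P[(fun w =>
                (eigencount (schrodinger sigma eta (fun l => omega l w) n)
                   (window r E n))%:R `^ (3 / 2))%R]%E
        | E in [set E : R | (-2 + eps < E < 2 - eps)%R]]
      | n in [set n : nat | (0 < n)%N]] < +oo)%E).
Proof.
have omega_std l : (0 < l)%N -> standardized (omega l).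
  case: omega_third => K HK l0.
  exact: (standardized_third_moment (omega_mean l l0) (omega_var l l0) (HK l
    l0)).
split=> [E r E2|r eps r0 eps0].
  have [c c0 Hc] := transfer_maximal sigma eta_gt0 eta_le omega_indep omega_std
    r E2.
  exists c => // t t0; exists 1%N => // n /= n0.
  have [A [mA PA HA]] := Hc t t0 n n0.
  exists A; split => // w Aw /=; split=> [l lam|psi mu Hpsi psi1 mur l ln].
    exact: HA.
  rewrite -!sqmodE -rmorphD /= !ltcR.
  have rn0 : 0 < rho E * n%:R.
    have dl0 : 0 < 1 - `|E| / 2 by move: E2; case: (ger0P E); lra.
    by rewrite mulr_gt0 ?ltr0n// (rho_gt0 dl0).
  (* The real parameter lam = (mu - E) rho n moves the energy from E to mu, and |lam| <= r. *)
  apply: (@eigenvector_profile _ sigma eta (fun l =>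
    omega l w) E n psi mu t ((mu - E) * (rho E * n%:R))%:C) => //.
    have rnC : (rho E * n%:R)%:C != 0 :> R[i] by rewrite eq_complex /= gt_eqF.
    by rewrite [X in X / _]rmorphM /= mulfK// rmorphB /= subrKC.
  move=> k kn; apply: HA => //.
  rewrite normc_def /= expr0n addr0 sqrtr_sqr lecR normrM (ger0_norm (ltW rn0)).
  by rewrite -ler_pdivlMr// ler_norml; lra.
(* Since |E| < 2 - eps gives 1 - |E|/2 > eps/2, one constant serves all these energies. *)
have d0 : 0 < eps / 2 by rewrite divr_gt0.
apply: (@le_lt_trans _ _ (count_bound sigma eta r (eps / 2))%:E);
  last by rewrite ltry.
apply: ge_ereal_sup => _ [n n0 <-]; apply: ge_ereal_sup => _ [E /= E2 <-].
apply: mean_eigencount => //.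
by move: E2; case: (ger0P E); lra.
Qed.
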